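(* Let $d=2$, $n\in\mathbb N$, and let $u_h^n=\sum_{i\in\mathcal V}U_i^n\phi_i\in V_h$. Let $w_h^{n+1}=\sum_{i\in\mathcal V}W_i^{n+1}\phi_i\in V_h$ be computed by the explicit hyperbolic prediction: for all $i\in\mathcal V$, $$m_i\frac{W_i^{n+1}-U_i^n}{\tau}+\sum_{j\in\mathcal I(i)}\Big(\mathbf f(U_j^n)\cdot\mathbf c_{ij}-d_{ij}^n(U_j^n-U_i^n)\Big)=0 .$$ Let $u_h^{n+1}=\sum_{i\in\mathcal V}U_i^{n+1}\phi_i\in V_h$ be computed by the implicit dispersive update with lumped mass matrix, i.e. $(u_h^{n+1},z_h^{n+1},g_h^{n+1})\in V_h\times V_h\times V_h$ satisfies, for all $i\in\mathcal V$ and all $r_h,s_h\in V_h$, $$\begin{aligned} & m_i\frac{U_i^{n+1}-W_i^{n+1}}{\tau}-\epsilon(\partial_x z_h^{n+1},\partial_x\phi_i)-\epsilon(\partial_x g_h^{n+1},\partial_y\phi_i)\\ &\qquad-\epsilon c(z_h^{n+1}-\partial_x u_h^{n+1},\partial_x\phi_i)-\epsilon c(g_h^{n+1}-\partial_y u_h^{n+1},\partial_y\phi_i)=0,\\ &(z_h^{n+1}-\partial_x u_h^{n+1},\,c\,r_h-\partial_x r_h)=0,\\ &(g_h^{n+1}-\partial_y u_h^{n+1},\,c\,s_h-\partial_x s_h)=0 . \end{aligned}$$ Then, for every $0<\tau\le\tau^*$ with $$\tau^*:=\min_{i\in\mathcal V}\frac{m_i}{4\sum_{j\in\mathcal I(i)}d_{ij}^n},$$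 the inequality $\|u_h^{n+1}\|_{l^2}\le\|u_h^n\|_{l^2}$ holds.
   Context: Setting. $D=[a,b]^d\subset\mathbb R^d$, and $\mathbf f:\mathbb R\to\mathbb R^d$ is a Lipschitz function (the flux). The numbers $\epsilon>0$, $c>0$ and the time step $\tau>0$ are constants. For $d=2$ the coordinates are $(x,y)$. $(\cdot,\cdot)$ is the $L^2(D)$ inner product. Finite element space. $\mathcal K_h$ is a mesh of $D$ (from a shape-regular family, covering $D$ exactly); $T_K:\hat K\to K$ is the affine map from the reference element $\hat K$ to $K\in\mathcal K_h$; $\hat P$ is the polynomial space of the reference element. $V_h$ is the space of functions $v\in C^0(D)$ that are periodic with respect to $D$ and satisfy $v|_K\circ T_K\in\hat P$ for all $K\in\mathcal K_h$. $\mathcal V=\{1,\dots,I\}$ enumerates the degrees of freedom and $\{\phi_i\}_{i\in\mathcal V}$ is the basis of global shape functions of $V_h$; it satisfies the partition of unity property $\sum_{i\in\mathcal V}\phi_i=1$. Set $\mathcal I(i)=\{j\in\mathcal V:\phi_j\phi_i\not\equiv0\}$, $$m_i=\int_D\phi_i\,dx,\qquad \mathbf c_{ij}=\int_D\phi_i\nabla\phi_j\,dx,\qquad \mathbf n_{ij}=\mathbf c_{ij}/\|\mathbf c_{ij}\|_{l^2},$$ where $\|\mathbf c_{ij}\|_{l^2}$ is the Euclidean norm. It is assumed that $m_i>0$ for all $i\in\mathcal V$. The weighted norm on $V_h$ is $\|v_h\|_{l^2}^2=\sum_{i\in\mathcal V}V_i^2m_i$ for $v_h=\sum_{i\in\mathcal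 V}V_i\phi_i$. Graph viscosity. $\lambda_{\max}(\mathbf n,U_L,U_R)$ denotes an upper bound on the maximum wave speed in the (entropy solution of the) one-dimensional Riemann problem $\partial_tu+\partial_x(\mathbf f(u)\cdot\mathbf n)=0$ with $u_0(x)=U_L$ for $x<0$ and $u_0(x)=U_R$ for $x>0$. Then $$d_{ij}^n=\max\big(\lambda_{\max}(\mathbf n_{ij},U_i^n,U_j^n)\|\mathbf c_{ij}\|_{l^2},\ \lambda_{\max}(\mathbf n_{ji},U_j^n,U_i^n)\|\mathbf c_{ji}\|_{l^2}\big),$$ a term with $\mathbf c_{ij}=0$ being understood as $0$. (If some denominator in the definition of $\tau^*$ vanishes, the corresponding quotient is $+\infty$.) *)

(* Defs.v *)
From HB Require Import structures.
From mathcomp Require Import all_boot all_order all_algebra.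
From mathcomp Require Import all_classical all_reals all_analysis.

Set Implicit Arguments.
Unset Strict Implicit.
Unset Printing Implicit Defensive.

Import Order.TTheory GRing.Theory Num.Theory.
Import numFieldNormedType.Exports.

Local Open Scope classical_set_scope.
Local Open Scope ring_scope.

(* R^2 is the product R * R.  The library norm on a product is the max norm,
   so the Euclidean norm is defined separately. *)

Definition dot2 (R : realType) (p q : R * R) : R := p.1 * q.1 + p.2 * q.2.

Definition enorm2 (R : realType) (p : R * R) : R := Num.sqrt (dot2 p p).

Definition ex2 (R : realType) : R * R := (1, 0).

Definition ey2 (R : realType) : R * R := (0, 1).

Definition leb2 (R : realType) : set (R * R) -> \bar R :=
  ((@lebesgue_measure R) \x (@lebesgue_measure R))%E.

Definition square (R : realType) (a b : R) : set (R * R) :=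
  [set p | (a <= p.1 <= b) && (a <= p.2 <= b)].

Definition inner (R : realType) (a b : R) (v w : R * R -> R) : R :=
  (\int[@leb2 R]_(p in square a b) (v p * w p))%R.

(* The polynomial space of the reference element is the span of the finite
   family [ref_poly] of polynomials in two variables. *)
Record fe_mesh (R : realType) := FEMesh {
  ref_elt : set (R * R);
  nloc : nat;
  ref_poly : 'I_nloc -> {poly {poly R}};
  ncell : nat;
  cell_map : 'I_ncell -> R * R -> R * R
}.

Definition eval2 (R : realType) (q : {poly {poly R}}) (p : R * R) : R :=
  (q.[p.2%:P]).[p.1].

Definition cell (R : realType) (Th : fe_mesh R) (k : 'I_(ncell Th)) :
  set (R * R) := cell_map k @` ref_elt Th.

Definition affine_iso (R : realType) (T : R * R -> R * R) : Prop :=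
  exists r1 r2 t : R * R, r1.1 * r2.2 - r1.2 * r2.1 != 0 /\
    forall p, T p = (dot2 r1 p + t.1, dot2 r2 p + t.2).

(* h_K <= sigma * rho_K for every cell K, with h_K the diameter of K and rho_K
   the diameter of the largest disc contained in K *)
Definition shape_regular (R : realType) (sigma : R) (Th : fe_mesh R) : Prop :=
  forall k : 'I_(ncell Th), exists (z : R * R) (r : R),
    [/\ 0 < r, [set p | enorm2 (p - z) <= r] `<=` cell k &
        forall p q, cell k p -> cell k q ->
          enorm2 (p - q) <= sigma * (2 * r)].

(* Triangles and squares are particular cases of the reference element. *)
Definition is_mesh (R : realType) (a b sigma : R) (Th : fe_mesh R) : Prop :=
  [/\ [/\ compact (ref_elt Th), convex_set (ref_elt Th)
        & (ref_elt Th)° !=set0],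
      forall k : 'I_(ncell Th), affine_iso (cell_map k),
      \bigcup_(k in [set: 'I_(ncell Th)]) cell k = square a b,
      forall k l : 'I_(ncell Th), k != l -> (cell k)° `&` (cell l)° = set0
    & shape_regular sigma Th].

(* Functions on the square are represented by total functions on R^2: only
   their values on the square matter. *)
Definition Vh (R : realType) (a b : R) (Th : fe_mesh R) (v : R * R -> R) :
    Prop :=
  [/\ {within square a b, continuous v},
      forall s, a <= s <= b -> v (a, s) = v (b, s) /\ v (s, a) = v (s, b)
    & forall k : 'I_(ncell Th), exists alpha : 'I_(nloc Th) -> R,
        forall p, ref_elt Th p ->
          v (cell_map k p) = \sum_l alpha l * eval2 (ref_poly l) p].

(* Derivative of [v] in the direction [e], computed inside each cell; the value
   on the mesh skeleton, a null set, is set to 0.  For [v] in [Vh] this is the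
   weak derivative. *)
Definition dpart (R : realType) (Th : fe_mesh R) (e : R * R)
    (v : R * R -> R) : R * R -> R :=
  fun p => if p \in \bigcup_(k in [set: 'I_(ncell Th)]) (cell k)°
           then 'D_e v p else 0.

Definition dx (R : realType) (Th : fe_mesh R) := dpart Th (ex2 R).

Definition dy (R : realType) (Th : fe_mesh R) := dpart Th (ey2 R).

Definition fe_fun (R : realType) (I : nat) (phi : 'I_I -> R * R -> R)
    (V : 'I_I -> R) : R * R -> R :=
  fun p => \sum_i V i * phi i p.

Definition is_basis (R : realType) (a b : R) (Th : fe_mesh R) (I : nat)
    (phi : 'I_I -> R * R -> R) : Prop :=
  [/\ forall i, Vh a b Th (phi i),
      forall V : 'I_I -> R,
        (forall p, square a b p -> fe_fun phi V p = 0) -> forall i, V i = 0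
    & forall v, Vh a b Th v -> exists V : 'I_I -> R,
        forall p, square a b p -> v p = fe_fun phi V p].

(* [stencil a b phi i j] means j \in I(i). *)
Definition stencil (R : realType) (a b : R) (I : nat)
    (phi : 'I_I -> R * R -> R) (i j : 'I_I) : bool :=
  `[< exists2 p, square a b p & phi j p * phi i p != 0 >].

Definition mass (R : realType) (a b : R) (I : nat)
    (phi : 'I_I -> R * R -> R) (i : 'I_I) : R :=
  (\int[@leb2 R]_(p in square a b) phi i p)%R.

Definition cvec (R : realType) (a b : R) (Th : fe_mesh R) (I : nat)
    (phi : 'I_I -> R * R -> R) (i j : 'I_I) : R * R :=
  (inner a b (phi i) (dx Th (phi j)), inner a b (phi i) (dy Th (phi j))).

Definition nvec (R : realType) (a b : R) (Th : fe_mesh R) (I : nat)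
    (phi : 'I_I -> R * R -> R) (i j : 'I_I) : R * R :=
  (enorm2 (cvec a b Th phi i j))^-1 *: cvec a b Th phi i j.

Definition lumped_norm (R : realType) (a b : R) (I : nat)
    (phi : 'I_I -> R * R -> R) (V : 'I_I -> R) : R :=
  Num.sqrt (\sum_i V i ^+ 2 * mass a b phi i).

(* One-dimensional conservation law: points of R^2 are now pairs (x, t). *)

Definition test_function (R : realType) (psi : R * R -> R) : Prop :=
  [/\ forall p, 0 <= psi p,
      forall p, derivable psi p (ex2 R) /\ derivable psi p (ey2 R),
      continuous ('D_(ex2 R) psi), continuous ('D_(ey2 R) psi)
    & exists2 K : set (R * R), compact K & forall p, ~ K p -> psi p = 0].

(* Bounded Kruzhkov entropy solution of u_t + g(u)_x = 0, u(., 0) = u0.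
   Test functions need not vanish at t = 0, so that the initial condition is
   part of the inequality. *)
Definition entropy_solution (R : realType) (g : R -> R) (u0 : R -> R)
    (u : R * R -> R) : Prop :=
  [/\ measurable_fun [set p : R * R | 0 < p.2] u,
      exists M, forall p, 0 < p.2 -> `|u p| <= M
    & forall (k : R) (psi : R * R -> R), test_function psi ->
        0 <= (\int[@leb2 R]_(p in [set p | (0 : R) < p.2])
                (`|u p - k| * 'D_(ey2 R) psi p
                 + Num.sg (u p - k) * (g (u p) - g k) * 'D_(ex2 R) psi p))%R
             + (\int[@lebesgue_measure R]_(x in setT)
                (`|u0 x - k| * psi (x, (0 : R))))%R].

Definition riemann_data (R : realType) (uL uR : R) : R -> R :=
  fun x => if x < 0 then uL else uR.

(* [lam] bounds the maximum wave speed of the Riemann problem: the entropy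
   solution (which is unique, and is taken here with a suitable representative
   of its almost-everywhere class) is undisturbed outside the cone
   |x| <= lam t. *)
Definition wave_speed_bound (R : realType) (g : R -> R) (uL uR lam : R) :
    Prop :=
  0 <= lam /\
  exists2 u, entropy_solution g (riemann_data uL uR) u &
    forall x t, 0 < t -> (x < - (lam * t) -> u (x, t) = uL) /\
                         (lam * t < x -> u (x, t) = uR).

(* If c_ij = 0, then nvec is 0 and the corresponding term is 0, whatever the
   value of lam. *)
Definition dvisc (R : realType) (a b : R) (Th : fe_mesh R) (I : nat)
    (phi : 'I_I -> R * R -> R) (lam : R * R -> R -> R -> R) (U : 'I_I -> R)
    (i j : 'I_I) : R :=
  Num.max
    (lam (nvec a b Th phi i j) (U i) (U j) * enorm2 (cvec a b Th phi i j))
    (lam (nvec a b Th phi j i) (U j) (U i) * enorm2 (cvec a b Th phi j i)).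

Definition tau_star (R : realType) (a b : R) (Th : fe_mesh R) (I : nat)
    (phi : 'I_I -> R * R -> R) (lam : R * R -> R -> R -> R) (U : 'I_I -> R) :
    \bar R :=
  (\big[mine/+oo]_(i < I)
    let S := (\sum_(j | stencil a b phi i j) dvisc a b Th phi lam U i j)%R in
    if S == 0%R then +oo else (mass a b phi i / (4 * S))%:E)%E.

Definition hyperbolic_step (R : realType) (a b : R) (Th : fe_mesh R)
    (I : nat) (phi : 'I_I -> R * R -> R) (f : R -> R * R)
    (lam : R * R -> R -> R -> R) (tau : R) (U W : 'I_I -> R) : Prop :=
  forall i, mass a b phi i * ((W i - U i) / tau)
    + \sum_(j | stencil a b phi i j)
        (dot2 (f (U j)) (cvec a b Th phi i j)
         - dvisc a b Th phi lam U i j * (U j - U i)) = 0.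

Definition dispersive_step (R : realType) (a b : R) (Th : fe_mesh R)
    (I : nat) (phi : 'I_I -> R * R -> R) (eps c tau : R)
    (W U : 'I_I -> R) (z g : R * R -> R) : Prop :=
  let u := fe_fun phi U in
  let p := fun x => z x - dx Th u x in
  let q := fun x => g x - dy Th u x in
  [/\ forall i, mass a b phi i * ((U i - W i) / tau)
        - eps * inner a b (dx Th z) (dx Th (phi i))
        - eps * inner a b (dx Th g) (dy Th (phi i))
        - eps * c * inner a b p (dx Th (phi i))
        - eps * c * inner a b q (dy Th (phi i)) = 0,
      forall r, Vh a b Th r -> inner a b p (fun x => c * r x - dx Th r x) = 0
    & forall s, Vh a b Th s -> inner a b q (fun x => c * s x - dx Th s x) = 0].

(* Main.v *)
Require Import Defs.
From HB Require Import structures.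
From mathcomp Require Import all_boot all_order all_algebra.
From mathcomp Require Import all_classical all_reals all_analysis.
From mathcomp Require Import measurable_realfun.
From mathcomp Require Import ring lra.

Set Implicit Arguments.
Unset Strict Implicit.
Unset Printing Implicit Defensive.

Import Order.TTheory GRing.Theory Num.Theory.
Import numFieldNormedType.Exports.

Local Open Scope classical_set_scope.
Local Open Scope ring_scope.

(** Write [m_i] for the lumped masses.  The inequality is the composition of
two stability estimates, [sum m_i W_i^2 <= sum m_i (U^n_i)^2] for the explicit
step and [sum m_i (U^(n+1)_i)^2 <= sum m_i W_i^2] for the implicit one.

Implicit step ([dispersive_energy]).  Put [p = z - u_x] and [q = g - u_y], test
the first equation with [u] and the other two with [z] and [g].  The right-hand
side becomes [eps ((z_x, z) + (g_x, g)) - eps c (|p|^2 + |q|^2)], and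
[2 (z_x, z)] is the integral of [(z^2)_x], which vanishes by periodicity.

Explicit step ([graph_viscosity_stable]).  Partition of unity gives
[sum_j c_ij = 0] and periodicity gives [sum_i c_ij = 0], so that all
conservative contributions cancel and only a pairwise inequality is needed: for
the flux [g] in the direction [n_ij], a primitive [Phi] of [g], [D = uR - uL]
and [d >= lam], the number
[E = D g(uR) - (Phi(uR) - Phi(uL)) - d D^2 / 2] is nonpositive and
[(d D - (g(uR) - g(uL)))^2 <= - 4 d E] ([riemann_dissipation]).  Together with
Cauchy-Schwarz and the bound on [tau] the quadratic terms created by the
explicit step are absorbed.  This replaces the usual entropy inequality for the
average of the Riemann solution, and no average has to be formed: the
inequality follows by integrating the bounds
[g(k) >= g(uL) - lam (k - uL)] and [g(k) >= g(uR) - lam (uR - k)], valid for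
[uL <= k <= uR] ([wave_speed_chord]; the case [uR < uL] is symmetric).

These bounds are all that is used about wave speeds ([cone_entropy]).  The
Kruzhkov inequalities for the two constants [k] and [K = uL] or [uR] are added
and tested with [alpha(x) beta(t)], where [alpha = 1] near the cone
[|x| <= lam t] as long as [beta] is nonzero.  Wherever [alpha'] is nonzero the
solution is known; inside the cone [|u - k| + |u - K| >= |K - k|] suffices,
whatever [u] is.

Periodicity is used through [gauss_x] and [gauss_y]: the cellwise derivative of
a continuous, periodic, cellwise smooth function has integral zero.  By Fubini
it is enough to look at lines.  The cells being convex with nonempty interior,
all but finitely many lines parallel to an axis meet the mesh skeleton in
finitely many points ([convex_family_skeleton]), and on such a line the
fundamental theorem of calculus holds with a finite exceptional set
([FTC_piecewise]). *)

(** * Bounded measurable functions and integration on rectangles *)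

(** Boundedness and measurability together give integrability on every set of
    finite measure, and are stable under products, which integrability is
    not. *)
Definition bmeas (d : measure_display) (T : measurableType d) (R : realType)
    (A : set T) (f : T -> R) : Prop :=
  measurable_fun A f /\ exists M, forall p, A p -> `|f p| <= M.

Section bounded_measurable.
Context (d : measure_display) (T : measurableType d) (R : realType).
Implicit Types (A : set T) (f g : T -> R).

Lemma bmeas_eq A f g : (forall p, A p -> f p = g p) -> bmeas A f -> bmeas A g.
Proof.
move=> fg [mf [M hM]]; split.
  by apply: (eq_measurable_fun f) => // p; rewrite inE => /fg.
by exists M => p Ap; rewrite -fg// hM.
Qed.

Lemma bmeas_cst A (r : R) : bmeas A (fun=> r).
Proof. by split; [exact: measurable_cst | exists `|r|]. Qed.

Lemma bmeasD A f g : bmeas A f -> bmeas A g -> bmeas A (fun p => f p + g p).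
Proof.
move=> [mf [M hM]] [mg [N hN]]; split; first exact: measurable_funD.
by exists (M + N) => p Ap; rewrite (le_trans (ler_normD _ _))// lerD ?hM ?hN.
Qed.

Lemma bmeasM A f g : bmeas A f -> bmeas A g -> bmeas A (fun p => f p * g p).
Proof.
move=> [mf [M hM]] [mg [N hN]]; split; first exact: measurable_funM.
by exists (M * N) => p Ap; rewrite normrM ler_pM ?hM ?hN.
Qed.

Lemma bmeasZ A f (r : R) : bmeas A f -> bmeas A (fun p => r * f p).
Proof. by move=> hf; apply: bmeasM => //; exact: bmeas_cst. Qed.

Lemma bmeasB A f g : bmeas A f -> bmeas A g -> bmeas A (fun p => f p - g p).
Proof.
move=> hf hg; apply: (bmeas_eq (f := fun p => f p + -1 * g p)).
  by move=> p _; rewrite mulN1r.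
by apply: bmeasD => //; exact: bmeasZ.
Qed.

Lemma bmeas_sum (J : Type) (s : seq J) (P : pred J) A (F : J -> T -> R) :
  (forall j, P j -> bmeas A (F j)) ->
  bmeas A (fun p => \sum_(j <- s | P j) F j p).
Proof.
move=> hF; elim: s => [|j s IH].
  by apply: bmeas_eq (bmeas_cst A 0) => p _; rewrite big_nil.
case: (boolP (P j)) => Pj; last first.
  by apply: bmeas_eq IH => p _; rewrite big_cons (negbTE Pj).
apply: bmeas_eq (bmeasD (hF _ Pj) IH) => p _.
by rewrite big_cons Pj.
Qed.

Lemma bmeasS A B f : measurable B -> A `<=` B -> bmeas B f -> bmeas A f.
Proof.
move=> mB AB [mf [M hM]]; split; first exact: measurable_funS mf.
by exists M => p /AB; exact: hM.
Qed.

Lemma bmeas_integrable (mu : {measure set T -> \bar R}) A f :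
  measurable A -> (mu A < +oo)%E -> bmeas A f ->
  mu.-integrable A (EFin \o f).
Proof.
move=> mA muA [mf [M hM]]; apply: measurable_bounded_integrable => //.
exists M; split; first exact: num_real.
by move=> N MN p Ap; exact: le_trans (hM _ Ap) (ltW MN).
Qed.

Lemma Rintegral_sum (mu : {measure set T -> \bar R}) A (J : Type) (s : seq J)
    (P : pred J) (F : J -> T -> R) :
  measurable A -> (mu A < +oo)%E -> (forall j, P j -> bmeas A (F j)) ->
  (\int[mu]_(p in A) \sum_(j <- s | P j) F j p =
   \sum_(j <- s | P j) \int[mu]_(p in A) F j p)%R.
Proof.
move=> mA muA hF; elim: s => [|j s IH].
  under eq_Rintegral do rewrite big_nil.
  by rewrite big_nil Rintegral_cst// mul0r.
under eq_Rintegral do rewrite big_cons.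
rewrite big_cons; case: ifPn => // Pj.
by rewrite RintegralD ?IH//; apply: bmeas_integrable => //;
  [exact: hF|exact: bmeas_sum].
Qed.

End bounded_measurable.

Section plane.
Variable R : realType.
Implicit Types (A B : set R) (O D : set (R * R)) (f : R * R -> R).
Notation R2 := (measurableTypeR R * measurableTypeR R)%type.
Notation mu := (@lebesgue_measure R).

(** The product sigma-algebra contains the Borel sets: an open set is the
    union of the balls with rational centre and radius [1/(n+1)] contained in
    it. *)
Lemma open_measurable2 O : open O -> measurable (O : set R2).
Proof.
move=> oO.
pose F (k : rat * rat * nat) : set (R * R) :=
  [set p | O p /\ forall p', ball (ratr k.1.1 : R, ratr k.1.2 : R) (k.2.+1%:R^-1) p' -> O p' ]
   `&` (ball (ratr k.1.1 : R) (k.2.+1%:R^-1) `*` ball (ratr k.1.2 : R) (k.2.+1%:R^-1)).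
have -> : O = \bigcup_k F k.
  apply/seteqP; split => [p Op|p [k _ [[]]]//].
  have /nbhs_ballP[e /= e0 he] : nbhs p O by exact: open_nbhs_nbhs.
  pose n := Num.truncn (2 / e).
  have hn : 2 * (n.+1%:R^-1 : R) < e.
    have := Num.Theory.truncnS_gt (2 / e); rewrite -/n => h.
    by rewrite mulrC ltr_pdivrMl// -ltr_pdivrMr.
  have n0 : 0 < (n.+1%:R^-1 : R) by [].
  have [r [rn rn0 rne]] : exists r : R, [/\ n.+1%:R^-1 = r, 0 < r & 2 * r < e].
    by exists (n.+1%:R^-1).
  have [q1 h1] := @rat_in_itvoo R (p.1 - r) (p.1 + r) ltac:(lra).
  have [q2 h2] := @rat_in_itvoo R (p.2 - r) (p.2 + r) ltac:(lra).
  move: h1 h2; rewrite !in_itv/= => /andP[h1 h1'] /andP[h2 h2'].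
  have b1 : ball (ratr q1 : R) (r) p.1.
    by rewrite /ball/= ltr_norml; lra.
  have b2 : ball (ratr q2 : R) (r) p.2.
    by rewrite /ball/= ltr_norml; lra.
  exists ((q1, q2), n) => //; rewrite /F/= rn; split => //; split => // p' [/= c1 c2].
  apply: he; split => /=.
    apply: (@le_ball _ _ _ (r + r)); first by lra.
    by apply: ball_triangle c1; exact: ball_sym.
  apply: (@le_ball _ _ _ (r + r)); first by lra.
  by apply: ball_triangle c2; exact: ball_sym.
apply: (@countable_bigcupT_measurable _ R2) => // k.
have [h|h] := pselect (forall p', ball (ratr k.1.1 : R, ratr k.1.2 : R) (k.2.+1%:R^-1) p' -> O p').
  rewrite (_ : F k = ball (ratr k.1.1 : R) (k.2.+1%:R^-1) `*` ball (ratr k.1.2 : R) (k.2.+1%:R^-1)).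
    by apply: measurableX; exact: measurable_ball.
  apply/seteqP; split => [p []//|p bp]; split => //; split => //.
  exact: h.
rewrite (_ : F k = set0)//.
by apply/seteqP; split => p // [[]].
Qed.

Lemma continuous_measurable_fun2 D f : measurable (D : set R2) ->
  {within D, continuous f} -> measurable_fun (D : set R2) f.
Proof.
move=> mD /continuousP cf; apply: (measurability _ (RGenOpens.measurableE R)).
move=> _ [_ [a [b ->] <-]].
have /open_subspaceP[V oV VD] :
    open (f @^-1` [set` `]a, b[] : set (subspace D)) by exact/cf/interval_open.
rewrite setIC -VD; apply: measurableI => //; exact: open_measurable2.
Qed.

Lemma measurable_rect A B : measurable A -> measurable B ->
  measurable (A `*` B : set R2).
Proof. exact: measurableX. Qed.

Lemma leb2_rect_lty A B : measurable A -> measurable B ->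
  (mu A < +oo)%E -> (mu B < +oo)%E -> ((mu \x mu) (A `*` B) < +oo)%E.
Proof.
move=> mA mB fA fB; rewrite product_measure1E// lte_mul_pinfty//.
by rewrite ge0_fin_numE.
Qed.

End plane.

Section fubini.
Variable R : realType.
Implicit Types (A B : set R) (f : R * R -> R).
Notation mu := (@lebesgue_measure R).
Notation R2 := (measurableTypeR R * measurableTypeR R)%type.

Lemma bmeas_section1 A B f (y : R) : measurable A -> measurable B ->
  bmeas (A `*` B : set R2) f -> B y -> bmeas A (fun x => f (x, y)).
Proof.
move=> mA mB [mf [M hM]] By; split; last by exists M => x Ax; apply: hM.
have /(measurable_restrictT f (measurable_rect mA mB)) := mf.
move=> /measurable_fun_pair1 - /(_ y) h.
apply: (eq_measurable_fun (fun x => (f \_ (A `*` B)) (x, y))); last first.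
  exact: measurable_funTS.
by move=> x; rewrite inE => Ax; rewrite patchT// inE.
Qed.

Lemma bmeas_section2 A B f (x : R) : measurable A -> measurable B ->
  bmeas (A `*` B : set R2) f -> A x -> bmeas B (fun y => f (x, y)).
Proof.
move=> mA mB [mf [M hM]] By; split; last by exists M => y Ay; apply: hM.
have /(measurable_restrictT f (measurable_rect mA mB)) := mf.
move=> /measurable_fun_pair2 - /(_ x) h.
apply: (eq_measurable_fun (fun y => (f \_ (A `*` B)) (x, y))); last first.
  exact: measurable_funTS.
by move=> y; rewrite inE => Ay; rewrite patchT// inE.
Qed.

Lemma Rintegral_rect21 A B f : measurable A -> measurable B ->
  (mu A < +oo)%E -> (mu B < +oo)%E -> bmeas (A `*` B : set R2) f ->
  (\int[(mu \x mu)%E]_(p in A `*` B) f p =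
   \int[mu]_(y in B) \int[mu]_(x in A) f (x, y))%R.
Proof.
move=> mA mB fA fB bf.
have mAB := measurable_rect mA mB.
have := bmeas_integrable mAB (leb2_rect_lty mA mB fA fB) bf.
move=> /integrable_mkcond => /(_ mAB) /integral21_prod_meas1 h.
rewrite /Rintegral integral_mkcond -h [in RHS]integral_mkcond; congr fine.
apply: eq_integral => y _; rewrite /fubini_G/= patchE.
case: ifPn => [/set_mem By|/negP Bny]; last first.
  apply: integral0_eq => x _; rewrite patchE ifF//.
  by apply/negP => /set_mem[/= _ By]; apply: Bny; rewrite inE.
rewrite fineK.
  rewrite [in RHS]integral_mkcond; apply: eq_integral => x _; rewrite !patchE/=.
  have [Ax|Ax] := boolP (x \in A).
    by rewrite ifT// inE; split => //; exact: set_mem.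
  by rewrite ifF//; apply/negP => /set_mem[/= Ax']; rewrite (mem_set Ax') in Ax.
apply: integrable_fin_num => //.
by apply: bmeas_integrable => //; exact: bmeas_section1 bf By.
Qed.

Lemma Rintegral_rect12 A B f : measurable A -> measurable B ->
  (mu A < +oo)%E -> (mu B < +oo)%E -> bmeas (A `*` B : set R2) f ->
  (\int[(mu \x mu)%E]_(p in A `*` B) f p =
   \int[mu]_(x in A) \int[mu]_(y in B) f (x, y))%R.
Proof.
move=> mA mB fA fB bf.
have mAB := measurable_rect mA mB.
have := bmeas_integrable mAB (leb2_rect_lty mA mB fA fB) bf.
move=> /integrable_mkcond => /(_ mAB) /integral12_prod_meas1 h.
rewrite /Rintegral integral_mkcond -h [in RHS]integral_mkcond; congr fine.
apply: eq_integral => x _; rewrite /fubini_F/= patchE.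
case: ifPn => [/set_mem By|/negP Bny]; last first.
  apply: integral0_eq => y _; rewrite patchE ifF//.
  by apply/negP => /set_mem[/= By _]; apply: Bny; rewrite inE.
rewrite fineK.
  rewrite [in RHS]integral_mkcond; apply: eq_integral => y _; rewrite !patchE/=.
  have [Ax|Ax] := boolP (y \in B).
    by rewrite ifT// inE; split => //; exact: set_mem.
  by rewrite ifF//; apply/negP => /set_mem[/= _ Ax']; rewrite (mem_set Ax') in Ax.
apply: integrable_fin_num => //.
by apply: bmeas_integrable => //; exact: bmeas_section2 bf By.
Qed.

End fubini.

(** * Fundamental theorem of calculus with exceptional points *)

Section one_dim.
Variable R : realType.
Implicit Types (F G H : R -> R) (a b : R).
Notation mu := (@lebesgue_measure R).

Lemma mu_itv_lty a b (x y : bool) :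
  (mu [set` Interval (BSide x a) (BSide y b)] < +oo)%E.
Proof.
rewrite lebesgue_measure_itv/=; case: ifPn => _; last exact: ltry.
by rewrite -EFinD ltry.
Qed.

(** Induction on the exceptional points: split the interval at one of them,
    and use the mean value theorem when none is left. *)
Lemma const_of_derive0 H (s : seq R) a b : a <= b ->
  {within `[a, b], continuous H} ->
  (forall x, a < x < b -> x \notin s -> is_derive x 1 H 0) -> H a = H b.
Proof.
elim: s a b => [|x0 s IH] a b ab cH dH.
  move: ab; rewrite le_eqVlt => /predU1P[->//|ab].
  have [x xab|c _ /eqP] := MVT (df := fun=> 0) ab _ cH.
    by apply: dH => //; move: xab; rewrite in_itv.
  by rewrite mul0r subr_eq0 => /eqP.
have [/andP[ax xb]|nx0] := boolP (a < x0 < b); last first.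
  apply: IH => // x xab xs; apply: dH => //; rewrite inE negb_or xs andbT.
  by apply: contraNneq nx0 => <-.
have -> : H a = H x0.
  apply: IH (ltW ax) _ _.
    apply: continuous_subspaceW cH => x/=; rewrite !in_itv/= => /andP[-> h].
    by rewrite (le_trans h)// ltW.
  move=> x /andP[ax' xx0] xs; apply: dH; first by rewrite ax' (lt_trans xx0).
  by rewrite inE negb_or xs andbT lt_eqF.
apply: IH (ltW xb) _ _.
  apply: continuous_subspaceW cH => x/=; rewrite !in_itv/= => /andP[h ->].
  by rewrite (le_trans _ h)// ltW.
move=> x /andP[ax' xx0] xs; apply: dH; first by rewrite xx0 (lt_trans _ ax').
by rewrite inE negb_or xs andbT gt_eqF.
Qed.

(** The difference between [F] and the indefinite integral of [G] is
    continuous and has derivative zero off [s]. *)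
Lemma FTC_piecewise F G (s : seq R) a b : a <= b ->
  {within `[a, b], continuous F} -> bmeas (`[a, b]%classic : set (measurableTypeR R)) G ->
  (forall x, a < x < b -> x \notin s ->
     is_derive x 1 F (G x) /\ {for x, continuous G}) ->
  (\int[mu]_(x in `[a, b]) G x)%R = F b - F a.
Proof.
move=> ab cF bG dF.
have iG : mu.-integrable `[a, b] (EFin \o G).
  by apply: bmeas_integrable => //; exact: mu_itv_lty.
pose H x := F x - parameterized_integral mu a x G.
have : H a = H b.
  apply: (@const_of_derive0 _ s) => //.
    move=> x; apply: (@continuousB _ R^o (subspace `[a, b])); first exact: cF.
    exact: parameterized_integral_continuous.
  move=> x xab xs; have [dFx cGx] := dF _ xab xs; move/andP: xab => [ax xb].
  have [d1 d2] := continuous_FTC1_closed xb iG ax cGx.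
  rewrite -(subrr (G x)); apply: is_deriveB.
  by split; [exact: d1|rewrite -d2 derive1E].
have E : parameterized_integral mu a a G = 0.
  by rewrite /parameterized_integral (@set_itv1 _ R) Rintegral_set1.
rewrite /H E subr0 /parameterized_integral => ->.
by rewrite opprB addrC subrK.
Qed.

(** Reduces directional derivatives to one variable. *)
Lemma is_derive_lineP (V : normedModType R) (f : V -> R) (p e : V) (df : R) :
  is_derive p e f df <-> is_derive (0 : R) 1 (fun h => f (h *: e + p)) df.
Proof.
have E : (fun h : R => h^-1 *: ((fun h : R => f (h *: e + p)) (h *: 1 + 0) -
   (fun h : R => f (h *: e + p)) 0)) = (fun h => h^-1 *: (f (h *: e + p) - f p)).
  by apply/funext => h/=; rewrite addr0 scale0r add0r [_ *: 1]mulr1.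
have E' : 'D_1 (fun h : R => f (h *: e + p)) 0 = 'D_e f p by rewrite /derive E.
split => -[d1 d2]; split.
- exact/(derivable1P f p e).1.
- by rewrite E'.
- exact/(derivable1P f p e).2.
- by rewrite -E'.
Qed.

End one_dim.

(** * Test functions adapted to a cone *)

Section positive_part.
Variable R : realType.
Implicit Types (x y t : R).

(** The simplest C1 function which vanishes on a half-line and not on the
    other; all test functions are built from it by composition. *)
Definition sqpos y : R := Num.max y 0 ^+ 2.

Lemma continuous_pospart : continuous (fun y : R => Num.max y 0).
Proof. by move=> y; apply: continuous_max => //; exact: cst_continuous. Qed.

Lemma is_derive_sqpos y : is_derive y 1 sqpos (2 * Num.max y 0).
Proof.
have [y0|y0|->] := ltgtP y 0.
- rewrite mulr0; apply: (near_eq_is_derive (f := cst 0)).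
  near=> x; rewrite /sqpos/= max_r ?expr0n// ltW//.
  by near: x; exact: lt_nbhsl.
- have : is_derive y 1 (fun x : R => x ^+ 2) (2 * y).
    apply: is_derive_eq; rewrite /GRing.scale/=; ring.
  apply: near_eq_is_derive; near=> x; rewrite /sqpos/= max_l// ltW//.
  by near: x; exact: lt_nbhsr.
- rewrite mulr0.
  have H : h^-1 *: (sqpos (h *: 1 + 0) - sqpos 0) @[h --> (0:R)^'] --> (0 : R).
    apply/cvgrPdist_le => /= e e0; near=> h.
    have h0 : h != 0 by near: h; exact: nbhs_dnbhs_neq.
    have he : `|h| <= e.
      by near: h; exact: dnbhs0_le.
    rewrite sub0r normrN addr0 [_ *: 1]mulr1 /sqpos maxxx expr0n/= subr0.
    rewrite normrM normfV ler_pdivrMl ?normr_gt0//.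
    apply: (@le_trans _ _ (`|h| * `|h|)); last by rewrite ler_wpM2l.
    rewrite expr2 normrM ler_pM// /Num.max; case: ifP => _ //; rewrite normr0//.
  split; first by apply/cvg_ex; exists 0.
  by apply/cvg_lim.
Unshelve. all: by end_near. Qed.

End positive_part.

Section continuity.
Context (R : realType) (T : topologicalType).
Implicit Types (f g : T -> R).

Lemma contD f g : continuous f -> continuous g -> continuous (fun x => f x + g x).
Proof. by move=> cf cg x; apply: cvgD; [exact: cf|exact: cg]. Qed.

Lemma contN f : continuous f -> continuous (fun x => - f x).
Proof. by move=> cf x; exact: cvgN (cf x). Qed.

Lemma contB f g : continuous f -> continuous g -> continuous (fun x => f x - g x).
Proof. by move=> cf cg x; apply: cvgB; [exact: cf|exact: cg]. Qed.

Lemma contM f g : continuous f -> continuous g -> continuous (fun x => f x * g x).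
Proof. by move=> cf cg x; apply: cvgM; [exact: cf|exact: cg]. Qed.

Lemma contC (a : R) : continuous (fun _ : T => a).
Proof. exact: cst_continuous. Qed.

Lemma cont_comp (h : R -> R) f : continuous f -> continuous h ->
  continuous (fun x => h (f x)).
Proof. by move=> cf ch x; exact: (cvg_comp _ _ (cf x) (ch (f x))). Qed.

Lemma cont_max0 f : continuous f -> continuous (fun x => Num.max (f x) 0).
Proof. by move=> cf; exact: (cont_comp cf (@continuous_pospart R)). Qed.

End continuity.

Section test_functions.
Variable R : realType.
Implicit Types (x y t l : R).

(** Equal to 1 for [|x| <= l] and to 0 for [|x| >= l + 1]. *)
Definition plateau l x : R := sqpos (1 - sqpos (x - l) - sqpos (- x - l)).

Definition plateau' l x : R :=
  2 * Num.max (1 - sqpos (x - l) - sqpos (- x - l)) 0 *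
  (2 * Num.max (- x - l) 0 - 2 * Num.max (x - l) 0).

(** Equal to [(1 - t^2)^2] on [[-1, 1]] and to 0 elsewhere. *)
Definition cutoff t : R := sqpos (1 - t ^+ 2).

Definition cutoff' t : R := - (4 * (t * Num.max (1 - t ^+ 2) 0)).

Lemma is_derive_plateau l x : is_derive x 1 (plateau l) (plateau' l x).
Proof.
have d1 : is_derive x 1 (fun x => sqpos (x - l)) (2 * Num.max (x - l) 0 * 1).
  apply: (@is_derive1_comp _ (@sqpos R) (fun x => x - l)).
    exact: is_derive_sqpos.
  by apply: is_derive_eq; rewrite subr0.
have d2 : is_derive x 1 (fun x => sqpos (- x - l)) (2 * Num.max (- x - l) 0 * -1).
  apply: (@is_derive1_comp _ (@sqpos R) (fun x => - x - l)).
    exact: is_derive_sqpos.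
  by apply: is_derive_eq; rewrite subr0.
rewrite /plateau /plateau'; apply: (@is_derive1_comp _ (@sqpos R)
  (fun x => 1 - sqpos (x - l) - sqpos (- x - l))).
  exact: is_derive_sqpos.
by apply: is_derive_eq; ring.
Qed.

Lemma is_derive_cutoff t : is_derive t 1 cutoff (cutoff' t).
Proof.
rewrite (_ : cutoff' t = 2 * Num.max (1 - t ^+ 2) 0 * (- (2 * t))); last first.
  by rewrite /cutoff'; ring.
apply: (@is_derive1_comp _ (@sqpos R) (fun t => 1 - t ^+ 2)).
  exact: is_derive_sqpos.
by apply: is_derive_eq; rewrite /GRing.scale/=; ring.
Qed.

Lemma derive_continuous (f f' : R -> R) : (forall x, is_derive x 1 f (f' x)) ->
  continuous f.
Proof.
by move=> df x; apply: differentiable_continuous; apply/derivable1_diffP; exact: ex_derive.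
Qed.

Lemma continuous_sqpos : continuous (@sqpos R).
Proof. exact: derive_continuous (@is_derive_sqpos R). Qed.

Lemma continuous_plateau' l : continuous (plateau' l).
Proof.
have cid : continuous (fun x : R => x) by move=> x; exact: cvg_id.
have cs (f : R -> R) : continuous f -> continuous (fun x => sqpos (f x)).
  by move=> cf; exact: (cont_comp cf continuous_sqpos).
apply: contM.
  apply: contM (@contC _ _ _) _; apply: cont_max0; apply: contB.
    by apply: contB (@contC _ _ _) _; apply: cs; apply: contB => //; exact: contC.
  by apply: cs; apply: contB; [exact: contN|exact: contC].
apply: contB; apply: contM (@contC _ _ _) _; apply: cont_max0; apply: contB;
  [exact: contN|exact: contC|exact: cid|exact: contC].
Qed.

Lemma continuous_cutoff' : continuous cutoff'.
Proof.
have cid : continuous (fun x : R => x) by move=> x; exact: cvg_id.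
apply: contN; apply: contM (@contC _ _ _) _; apply: contM => //.
by apply: cont_max0; apply: contB (@contC _ _ _) _; exact: exprn_continuous.
Qed.

Lemma sqpos_ge0 y : 0 <= sqpos y. Proof. exact: sqr_ge0. Qed.

Lemma sqpos_le0 y : y <= 0 -> sqpos y = 0.
Proof. by move=> y0; rewrite /sqpos max_r// expr0n. Qed.

Lemma sqpos_ge1 y : 1 <= y -> 1 <= sqpos y.
Proof.
by move=> y0; rewrite /sqpos max_l ?exprn_ege1//; rewrite (le_trans _ y0).
Qed.

Lemma plateau1 l x : `|x| <= l -> plateau l x = 1.
Proof.
rewrite ler_norml => /andP[h1 h2]; rewrite /plateau !(@sqpos_le0 (_ - l)); try lra.
by rewrite !subr0 /sqpos max_l ?expr1n.
Qed.

Lemma plateau'0 l x : `|x| <= l -> plateau' l x = 0.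
Proof.
rewrite ler_norml => /andP[h1 h2]; rewrite /plateau'.
by rewrite !(@max_r _ _ (_ - l)); [rewrite mulr0 subrr mulr0|lra|lra].
Qed.

Lemma plateau_arg_le0 l x : l + 1 <= `|x| ->
  1 - sqpos (x - l) - sqpos (- x - l) <= 0.
Proof.
move=> h; have := sqpos_ge0 (x - l); have := sqpos_ge0 (- x - l).
have [x0|x0] := leP 0 x; move: h.
  by rewrite ger0_norm// => h; have := @sqpos_ge1 (x - l); lra.
by rewrite ltr0_norm// => h; have := @sqpos_ge1 (- x - l); lra.
Qed.

Lemma plateau_out l x : l + 1 <= `|x| -> plateau l x = 0.
Proof. by move=> /plateau_arg_le0 h; exact: sqpos_le0. Qed.

Lemma plateau'_out l x : l + 1 <= `|x| -> plateau' l x = 0.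
Proof.
by move=> /plateau_arg_le0 h; rewrite /plateau' max_r// mulr0 mul0r.
Qed.

Lemma cutoff_out t : 1 <= `|t| -> cutoff t = 0.
Proof.
by move=> h; apply: sqpos_le0; rewrite subr_le0 -real_normK ?num_real// exprn_ege1.
Qed.

Lemma cutoff'_out t : 1 <= `|t| -> cutoff' t = 0.
Proof.
move=> h; rewrite /cutoff' max_r ?mulr0 ?oppr0//.
by rewrite subr_le0 -real_normK ?num_real// exprn_ege1.
Qed.

Lemma cutoff0 : cutoff 0 = 1.
Proof. by rewrite /cutoff expr0n/= subr0 /sqpos max_l// expr1n. Qed.

Lemma cutoff'_le0 t : 0 <= t -> cutoff' t <= 0.
Proof.
move=> t0; rewrite oppr_le0 mulr_ge0// mulr_ge0// le_max lexx orbT//.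
Qed.

Definition cone_test l : R * R -> R := fun p => plateau l p.1 * cutoff p.2.

Lemma is_derive_cone_testx l p :
  is_derive p (ex2 R) (cone_test l) (plateau' l p.1 * cutoff p.2).
Proof.
apply/is_derive_lineP.
rewrite (_ : (fun h : R => _) = (fun h : R => cutoff p.2 * plateau l (h + p.1))).
  have -> : plateau' l p.1 * cutoff p.2 = cutoff p.2 * (plateau' l (0 + p.1) * 1).
    by rewrite add0r mulr1 mulrC.
  apply: is_deriveZ.
  apply: (@is_derive1_comp _ (plateau l) (fun h => h + p.1)).
    exact: is_derive_plateau.
  by apply: is_derive_eq; rewrite addr0.
by apply/funext => h; rewrite /cone_test/= [h *: 1]mulr1 [h *: 0]mulr0 add0r mulrC.
Qed.

Lemma is_derive_cone_testy l p :
  is_derive p (ey2 R) (cone_test l) (plateau l p.1 * cutoff' p.2).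
Proof.
apply/is_derive_lineP.
rewrite (_ : (fun h : R => _) = (fun h : R => plateau l p.1 * cutoff (h + p.2))).
  rewrite -[cutoff' _]mulr1 -[in cutoff' _](add0r p.2).
  apply: is_deriveZ.
  apply: (@is_derive1_comp _ cutoff (fun h => h + p.2)).
    exact: is_derive_cutoff.
  by apply: is_derive_eq; rewrite addr0.
by apply/funext => h; rewrite /cone_test/= [h *: 1]mulr1 [h *: 0]mulr0 add0r.
Qed.

Lemma test_function_cone_test l : test_function (cone_test l).
Proof.
have cfst (f : R -> R) : continuous f -> continuous (fun p : R * R => f p.1).
  by move=> cf p; apply: (continuous_comp (f := fst)); [exact: cvg_fst|exact: cf].
have csnd (f : R -> R) : continuous f -> continuous (fun p : R * R => f p.2).
  by move=> cf p; apply: (continuous_comp (f := snd)); [exact: cvg_snd|exact: cf].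
split.
- by move=> p; rewrite mulr_ge0// sqpos_ge0.
- by move=> p; split; apply: ex_derive; [exact: is_derive_cone_testx|exact: is_derive_cone_testy].
- rewrite (_ : 'D_(ex2 R) _ = (fun p => plateau' l p.1 * cutoff p.2)).
    apply: contM; [apply: cfst|apply: csnd].
      exact: continuous_plateau'.
    exact: derive_continuous is_derive_cutoff.
  by apply/funext => p; have [_ ->] := is_derive_cone_testx l p.
- rewrite (_ : 'D_(ey2 R) _ = (fun p => plateau l p.1 * cutoff' p.2)).
    apply: contM; [apply: cfst|apply: csnd].
      exact: derive_continuous (is_derive_plateau l).
    exact: continuous_cutoff'.
  by apply/funext => p; have [_ ->] := is_derive_cone_testy l p.
- exists (`[- (l + 1), l + 1] `*` `[-1, 1])%classic.
    by apply: compact_setX; exact: segment_compact.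
  move=> p np; rewrite /cone_test.
  have [h1|h1] := leP (l + 1) `|p.1|; first by rewrite plateau_out ?mul0r.
  have [h2|h2] := leP 1 `|p.2|; first by rewrite cutoff_out ?mulr0.
  exfalso; apply: np; split => /=; rewrite in_itv/= -ler_norml; exact: ltW.
Qed.

End test_functions.

Lemma near_continuous (T : topologicalType) (R : realType) (f g : T -> R) x :
  (\near x, f x = g x) -> {for x, continuous f} -> {for x, continuous g}.
Proof.
move=> fg cf; have fgx : f x = g x by exact: nbhs_singleton fg.
by rewrite /prop_for /continuous_at -fgx; apply: cvg_trans cf; exact: near_eq_cvg.
Qed.

Section rect_functions.
Variable R : realType.
Notation mu := (@lebesgue_measure R).
Notation R1 := (measurableTypeR R).
Notation R2 := (measurableTypeR R * measurableTypeR R)%type.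

Lemma continuous_bmeas (a b : R) (f : R -> R) : continuous f ->
  bmeas (`[a, b]%classic : set R1) f.
Proof.
move=> cf; split; first exact: measurable_funTS (continuous_measurable_fun cf).
have /compact_bounded[M [_ hM]] : compact (f @` `[a, b]).
  apply: continuous_compact; last exact: segment_compact.
  exact: continuous_subspaceT.
by exists (M + 1) => x xab; apply: (hM (M + 1)); [rewrite ltrDl|exists x].
Qed.

Lemma bmeas_fst (A B : set R) (f : R -> R) : measurable A -> measurable B ->
  bmeas (A : set R1) f -> bmeas (A `*` B : set R2) (fun p => f p.1).
Proof.
move=> mA mB [mf [M hM]]; split; last by exists M => p [Ap _]; exact: hM.
have mf' := (measurable_restrictT f mA).1 mf.
apply: (eq_measurable_fun (fun p : R2 => (f \_ A) p.1)).
  by move=> p /set_mem[Ap _]; rewrite patchT// inE.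
apply: measurable_funTS; apply: (measurableT_comp mf').
exact: measurable_fst.
Qed.

Lemma bmeas_snd (A B : set R) (f : R -> R) : measurable A -> measurable B ->
  bmeas (B : set R1) f -> bmeas (A `*` B : set R2) (fun p => f p.2).
Proof.
move=> mA mB [mf [M hM]]; split; last by exists M => p [_ Ap]; exact: hM.
have mf' := (measurable_restrictT f mB).1 mf.
apply: (eq_measurable_fun (fun p : R2 => (f \_ B) p.2)).
  by move=> p /set_mem[_ Ap]; rewrite patchT// inE.
apply: measurable_funTS; apply: (measurableT_comp mf').
exact: measurable_snd.
Qed.

Lemma bmeas_ite d (T : measurableType d) (A : set T) (c : T -> bool) (x y : R) :
  measurable_fun setT c -> bmeas A (fun p => if c p then x else y).
Proof.
move=> mc; split; first exact: measurable_funTS (measurable_fun_ifT mc _ _).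
exists (`|x| + `|y|) => p _; case: ifP => _; rewrite ?lerDl ?lerDr//.
Qed.

(** Both ends of the interval occur below: a half-open and a closed interval
    partition the cone section [[-w, w]]. *)
Lemma Rintegral_itv_indicator (a b x y c : R) (z : bool) : a <= x -> y <= b -> x <= y ->
  (\int[mu]_(s in `[a, b])
     (if s \in Interval (BLeft x) (BSide z y) then c else 0))%R = c * (y - x).
Proof.
move=> ax yb xy; pose J := Interval (BLeft x) (BSide z y).
transitivity (\int[mu]_(s in `[a, b]) ((cst c : R -> R) \_ [set` J]) s)%R.
  by apply: eq_Rintegral => s _; rewrite patchE mem_setE.
rewrite -Rintegral_mkcondr (_ : _ `&` _ = [set` J]); last first.
  apply/seteqP; split => [s []//|s/=] sJ; split => //; move: sJ.
  rewrite /J !itv_boundlr/= !bnd_simp => /andP[xs sy].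
  rewrite (le_trans ax xs)/=; case: (z) sy => /=; rewrite bnd_simp => sy.
    by rewrite ltW// (lt_le_trans sy).
  by rewrite (le_trans sy).
rewrite Rintegral_cst//; have := @lebesgue_measure_itv R J => /= ->.
rewrite lte_fin; case: ltP => h; first by rewrite -EFinD.
by rewrite (_ : y - x = 0)// ; apply/eqP; rewrite subr_eq0 eq_le h xy.
Qed.

Lemma Rintegral_support d (T : measurableType d)
    (m : {measure set T -> \bar R}) (A B : set T) (f : T -> R) :
  B `<=` A -> (forall p, A p -> ~ B p -> f p = 0) ->
  (\int[m]_(p in A) f p = \int[m]_(p in B) f p)%R.
Proof.
move=> BA f0; rewrite Rintegral_mkcond [RHS]Rintegral_mkcond.
apply: eq_Rintegral => p _; rewrite !patchE.
have [Bp|nBp] := pselect (B p).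
  by rewrite !mem_set//; exact: BA.
rewrite (memNset nBp); case: ifPn => // /set_mem Ap; exact: f0.
Qed.

End rect_functions.

(** * Wave speed bounds and Kruzhkov inequalities *)

Section cone.
Variable R : realType.
Implicit Types (l lam w x t k K : R).
Notation mu := (@lebesgue_measure R).
Notation R1 := (measurableTypeR R).
Notation R2 := (measurableTypeR R * measurableTypeR R)%type.

Definition two_state (yL yR x : R) : R := if x < 0 then yL else yR.

(** The correction to [two_state yL yR] that replaces both values by [yM] on
    the section [[-w, w]] of the cone. *)
Definition cone_jump (w yL yR yM x : R) : R :=
  (if x \in `[- w, 0[ then yM - yL else 0) +
  (if x \in `[0, w] then yM - yR else 0).

Lemma two_stateL yL yR x : x < 0 -> two_state yL yR x = yL.
Proof. by rewrite /two_state => ->. Qed.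

Lemma two_stateR yL yR x : 0 <= x -> two_state yL yR x = yR.
Proof. by rewrite /two_state ltNge => ->. Qed.

Lemma bmeas_two_state (A : set R1) yL yR : bmeas A (two_state yL yR).
Proof. by apply: bmeas_ite; exact: measurable_fun_ltr. Qed.

Lemma bmeas_cone_jump (A : set R2) lam yL yR yM :
  bmeas A (fun p => cone_jump (lam * p.2) yL yR yM p.1).
Proof.
have mt : measurable_fun [set: R2] (fun p => lam * p.2).
  by apply: measurable_funM => //; exact: measurable_snd.
have mf : measurable_fun [set: R2] (fun p => p.1 : R) by exact: measurable_fst.
apply: bmeasD; apply: bmeas_ite; under eq_fun do rewrite in_itv/=.
  apply: measurable_and; last exact: measurable_fun_ltr.
  by apply: measurable_fun_ler => //; exact: measurableT_comp.
by apply: measurable_and; exact: measurable_fun_ler.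
Qed.

(** On the cone section the plateau equals 1, so the left-hand side is [yM]
    there; outside, [y] is one of the two states. *)
Lemma cone_jump_le l w yL yR yM x y : 0 <= w <= l -> yM <= y ->
  (x < - w -> y = yL) -> (w < x -> y = yR) ->
  plateau l x * two_state yL yR x + cone_jump w yL yR yM x <= plateau l x * y.
Proof.
move=> /andP[w0 wl] yMy hL hR; rewrite /cone_jump !in_itv/=.
have [x0|x0] := ltP x 0.
  rewrite two_stateL// andbT addr0.
  have [xw|xw] := leP (- w) x; last by rewrite hL// addr0.
  rewrite plateau1 ?mul1r; first by rewrite addrC subrK.
  by rewrite ltr0_norm// lerNl (le_trans _ xw)// lerN2.
rewrite two_stateR// andbF add0r/=.
have [xw|xw] := leP x w; last by rewrite hR// addr0.
rewrite plateau1 ?mul1r; first by rewrite addrC subrK.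
by rewrite ger0_norm// (le_trans xw).
Qed.

Lemma Rintegral_cone_jump w L yL yR yM : 0 <= w <= L ->
  (\int[mu]_(x in `[(- L)%R, L]) cone_jump w yL yR yM x)%R =
  (2 * yM - yL - yR) * w.
Proof.
move=> /andP[w0 wL].
have wL' : - L <= - w by rewrite lerN2.
have w0' : - w <= 0 by rewrite oppr_le0.
have L0 := le_trans w0 wL; have L0' : - L <= 0 by rewrite oppr_le0.
have ii c (J : interval R) : mu.-integrable `[(- L)%R, L]
    (EFin \o (fun x => if x \in J then c else 0 : R)).
  apply: bmeas_integrable => //; first exact: mu_itv_lty.
  apply: bmeas_ite; apply: (@measurable_fun_bool _ _ _ _ true).
  by rewrite setTI; exact: measurable_itv.
rewrite RintegralD//; [|exact: ii..].
rewrite (@Rintegral_itv_indicator _ (- L) L)// (@Rintegral_itv_indicator _ (- L) L)//.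
by ring.
Qed.

(** [(plateau l - 1) * two_state QL QR] is a primitive: the jump at 0 is
    harmless because [plateau l - 1] vanishes near 0. *)
Lemma Rintegral_plateau' l QL QR : 0 < l ->
  (\int[mu]_(x in `[(- (l + 1))%R, (l + 1)%R])
     (plateau' l x * two_state QL QR x))%R = QL - QR.
Proof.
move=> l0; have L0 : 0 < l + 1 by rewrite addr_gt0.
pose F x := (plateau l x - 1) * two_state QL QR x.
(* Off 0 the step function is locally constant. *)
have qx x : x != 0 -> \forall y \near x, two_state QL QR y = two_state QL QR x.
  rewrite neq_lt => /orP[x0|x0]; near=> y.
    by rewrite !two_stateL//; near: y; exact: lt_nbhsl.
  by rewrite !two_stateR ?ltW//; near: y; exact: lt_nbhsr.
have dF x : is_derive (x : R) 1 F (plateau' l x * two_state QL QR x).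
  have [->|x0] := eqVneq x 0.
    rewrite plateau'0 ?normr0 ?ltW// mul0r.
    apply: (near_eq_is_derive (f := cst 0)); near=> y.
    by rewrite /F plateau1 ?subrr ?mul0r//; near: y; exact: nbhs0_le.
  have d : is_derive x 1 (fun x => two_state QL QR x * (plateau l x - 1))
      (two_state QL QR x * plateau' l x).
    have : is_derive x 1 (fun y => two_state QL QR x * (plateau l y - 1))
        (two_state QL QR x * plateau' l x).
      apply: is_deriveZ; rewrite -[plateau' l x]subr0.
      by apply: is_deriveB; exact: is_derive_plateau.
    apply: near_eq_is_derive; near=> y; congr (_ * _); apply/esym.
    by near: y; exact: qx.
  rewrite mulrC; apply: near_eq_is_derive d; near=> y; exact: mulrC.
rewrite (@FTC_piecewise _ F _ [:: 0])//.
- rewrite /F !plateau_out ?normrN ?(ger0_norm (ltW L0))//.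
  rewrite (two_stateL _ _ (_ : - (l + 1) < 0)) ?oppr_lt0//.
  by rewrite (two_stateR _ _ (ltW L0)); ring.
- by rewrite ge0_cp// ltW.
- by apply: continuous_subspaceT; exact: derive_continuous dF.
- apply: bmeasM; last exact: bmeas_two_state.
  by apply: continuous_bmeas; exact: continuous_plateau'.
move=> x _; rewrite inE => x0; split; first exact: dF.
apply: (@near_continuous _ _ (fun y => plateau' l y * two_state QL QR x)).
  by near=> y; congr (_ * _); apply/esym; near: y; exact: qx.
by apply: contM; [exact: continuous_plateau'|exact: contC].
Unshelve. all: by end_near. Qed.

(** Integration by parts in time; [8 / 15] is the integral of [cutoff] over
    [[0, 1]]. *)
Lemma Rintegral_cutoff (c0 c1 q : R) :
  (\int[mu]_(t in `]0%R, 1%R])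
     (cutoff' t * (c0 + c1 * t) + cutoff t * q))%R = - c0 + 8 / 15 * (q - c1).
Proof.
have cid : continuous (fun x : R => x) by move=> x; exact: cvg_id.
pose G t := cutoff' t * (c0 + c1 * t) + cutoff t * q.
have cG : continuous G.
  apply: contD; apply: contM.
  - exact: continuous_cutoff'.
  - by apply: contD; [exact: contC|apply: contM => //; exact: contC].
  - exact: derive_continuous (@is_derive_cutoff R).
  - exact: contC.
have bG : bmeas (`[0, 1]%classic : set R1) G by exact: continuous_bmeas.
rewrite Rintegral_itv_obnd_cbnd; last first.
  apply: bmeas_integrable => //; first exact: mu_itv_lty.
  apply: bmeasS bG => // x /=.
  by rewrite !in_itv/= => /andP[/ltW -> ->].
pose F t := cutoff t * (c0 + c1 * t) +
  (q - c1) * (t - 2 / 3 * t ^+ 3 + 1 / 5 * t ^+ 5).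
have dF t : is_derive (t : R) 1 F (cutoff' t * (c0 + c1 * t) +
   cutoff t * c1 + (q - c1) * (1 - 2 * t ^+ 2 + t ^+ 4)).
  have h1 := is_derive_cutoff t.
  by rewrite /F; apply: is_derive_eq; rewrite /GRing.scale/=; field.
rewrite (@FTC_piecewise _ F _ [::])//.
- by rewrite /F cutoff0 cutoff_out ?normr1//; field.
- by apply: continuous_subspaceT; exact: derive_continuous dF.
move=> t /andP[t0 t1] _; split; last exact: cG.
have := dF t; congr (is_derive _ _ _ _); rewrite /G.
have -> : cutoff t = (1 - t ^+ 2) ^+ 2.
  by rewrite /cutoff /sqpos max_l// subr_ge0 expr_le1// ltW.
by ring.
Qed.

End cone.

Section kruzhkov_cone.
Variable R : realType.
Notation mu := (@lebesgue_measure R).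
Notation R1 := (measurableTypeR R).
Notation R2 := (measurableTypeR R * measurableTypeR R)%type.

(** Kruzhkov flux associated with the entropy [fun s => `|s - k|]. *)
Definition kflux (g : R -> R) (k s : R) : R := Num.sg (s - k) * (g s - g k).

(** Add the entropy inequalities for [k] and [K], tested with [cone_test]. The
    integral of the initial data cancels against part of the time derivative
    term, and what remains is the stated inequality times [8 / 15].  The
    constants [k] and [K] enter together because the triangle inequality bounds
    [|u - k| + |u - K|] from below without any knowledge of [u]. *)
Lemma cone_entropy (g : R -> R) (uL uR lam k K : R) :
  wave_speed_bound g uL uR lam ->
  lam * (2 * `|K - k| - (`|uL - k| + `|uL - K|) - (`|uR - k| + `|uR - K|)) <=
  (kflux g k uL + kflux g K uL) - (kflux g k uR + kflux g K uR).
Proof.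
move=> [lam0 [u [mu_ [M hM] hent] hu]].
set eL := `|uL - k| + `|uL - K|; set eR := `|uR - k| + `|uR - K|.
set QL := kflux g k uL + kflux g K uL; set QR := kflux g k uR + kflux g K uR.
set eM := `|K - k|; pose l := lam + 1; pose L := l + 1.
have l0 : 0 < l by rewrite ltr_wpDl.
pose H : set R2 := [set p | 0 < p.2].
pose box : set R2 := (`[- L, L] `*` `]0, 1])%classic.
pose X (c : R) (p : R * R) : R := `|u p - c| * (plateau l p.1 * cutoff' p.2) +
  Num.sg (u p - c) * (g (u p) - g c) * (plateau' l p.1 * cutoff p.2).
have mI : measurable (`[- L, L]%classic : set R1) by [].
have mJ : measurable (`]0, 1]%classic : set R1) by [].
have fI : (mu `[(- L)%R, L] < +oo)%E by exact: mu_itv_lty.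
have fJ : (mu `](0 : R)%R, 1%R] < +oo)%E by exact: mu_itv_lty.
have mbox : measurable box by exact: measurable_rect.
have fbox : ((mu \x mu) box < +oo)%E by exact: leb2_rect_lty.
have mH : measurable H.
  apply: open_measurable2; apply: (@open_comp _ _ snd [set y : R | 0 < y]).
    by move=> p _; exact: cvg_snd.
  exact: open_gt.
have boxH : box `<=` H by move=> p [_ /=]; rewrite in_itv/= => /andP[].
have tbox p : box p -> 0 < p.2 /\ p.2 <= 1.
  by move=> [_ /=]; rewrite in_itv/= => /andP[].
have XH c : (\int[(mu \x mu)%E]_(p in H) X c p =
    \int[(mu \x mu)%E]_(p in box) X c p)%R.
  apply: Rintegral_support => // p Hp nb; rewrite /X.
  have [h|h] := leP (l + 1) `|p.1|.
    by rewrite plateau_out// plateau'_out// !mul0r !mulr0 addr0.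
  have [h'|h'] := leP 1 `|p.2|.
    by rewrite cutoff_out// cutoff'_out// !mulr0 addr0.
  exfalso; apply: nb; split => /=; rewrite in_itv/=; first by rewrite -ler_norml ltW.
  by rewrite Hp/= (le_trans (ler_norm _))// ltW.
have lt_l t : t <= 1 -> lam * t < l.
  by move=> t1; rewrite (@le_lt_trans _ _ (lam * 1))// ?ler_wpM2l// mulr1 ltrDl.
(* Where the x-derivative of the test function is nonzero, the point lies
   outside the cone, and u is known there. *)
have EX c p : box p -> X c p = `|u p - c| * (plateau l p.1 * cutoff' p.2) +
    two_state (kflux g c uL) (kflux g c uR) p.1 * (plateau' l p.1 * cutoff p.2).
  move=> bp; rewrite /X; congr (_ + _).
  have [h|h] := leP `|p.1| l; first by rewrite plateau'0// mul0r !mulr0.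
  have [p0 p1] := tbox _ bp; have lt := lt_l _ p1.
  have [hL hR] := hu p.1 p.2 p0; rewrite -surjective_pairing in hL hR.
  have [x0|x0] := ltP p.1 0.
    by rewrite two_stateL// hL// ltrNr (lt_trans lt)// -ltr0_norm.
  by rewrite two_stateR// hR// (lt_trans lt)// -(ger0_norm x0).
have bu : bmeas box u.
  split; first exact: measurable_funS mH boxH mu_.
  by exists M => p bp; apply: hM; exact: boxH.
have bun c : bmeas box (fun p => `|u p - c|).
  have [m1 [N hN]] := bmeasB bu (bmeas_cst box c).
  split; first exact: measurableT_comp m1.
  by exists N => p bp; rewrite normr_id hN.
have bfst (f : R -> R) : continuous f -> bmeas box (fun p => f p.1).
  by move=> cf; apply: bmeas_fst => //; exact: continuous_bmeas.
have bsnd (f : R -> R) : continuous f -> bmeas box (fun p => f p.2).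
  move=> cf; apply: bmeas_snd => //; apply: bmeasS (continuous_bmeas 0 1 cf) => //.
  by move=> x /=; rewrite !in_itv/= => /andP[/ltW -> ->].
have b2 yL yR : bmeas box (fun p => two_state yL yR p.1).
  by apply: bmeas_fst => //; exact: bmeas_two_state.
have cpl := derive_continuous (is_derive_plateau l).
have ccu := derive_continuous (@is_derive_cutoff R).
have cpl' := @continuous_plateau' R l.
have ccu' := @continuous_cutoff' R.
have bX c : bmeas box (X c).
  apply: bmeas_eq (fun p bp => esym (EX c p bp)) _.
  by apply: bmeasD; apply: bmeasM => //; apply: bmeasM; (exact: bfst || exact: bsnd).
pose J t x := cone_jump (lam * t) eL eR eM x.
pose Y (p : R * R) := cutoff' p.2 * (plateau l p.1 * two_state eL eR p.1 + J p.2 p.1)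
  + cutoff p.2 * (plateau' l p.1 * two_state QL QR p.1).
have bA : bmeas box (fun p => plateau l p.1 * two_state eL eR p.1).
  by apply: bmeasM => //; exact: bfst.
have bJ : bmeas box (fun p => J p.2 p.1) by exact: bmeas_cone_jump.
have bB : bmeas box (fun p => plateau' l p.1 * two_state QL QR p.1).
  by apply: bmeasM => //; exact: bfst.
have bY : bmeas box Y.
  by apply: bmeasD; apply: bmeasM => //; [exact: bsnd|exact: bmeasD|exact: bsnd].
have leXY p : box p -> X k p + X K p <= Y p.
  move=> bp; rewrite !EX//; have [p0 p1] := tbox _ bp.
  have [hL hR] := hu p.1 p.2 p0; rewrite -surjective_pairing in hL hR.
  have w : 0 <= lam * p.2 <= l by rewrite mulr_ge0 ?(ltW p0)// ltW ?lt_l.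
  have core : plateau l p.1 * two_state eL eR p.1 + J p.2 p.1 <=
      plateau l p.1 * (`|u p - k| + `|u p - K|).
    apply: cone_jump_le w _ _ _; last 2 first.
    - by move=> /hL ->.
    - by move=> /hR ->.
    rewrite (_ : eM = `|(u p - k) - (u p - K)|) ?ler_normB//.
    by congr `| _ |; ring.
  have Eq : two_state QL QR p.1 = two_state (kflux g k uL) (kflux g k uR) p.1 +
      two_state (kflux g K uL) (kflux g K uR) p.1.
    by rewrite /two_state; case: ifP.
  have := ler_wnM2l (cutoff'_le0 (ltW p0)) core; rewrite /Y Eq.
  by rewrite -subr_ge0 => h; rewrite -subr_ge0 (le_trans h)// le_eqVlt;
    apply/orP; left; apply/eqP; ring.
pose C0 := (\int[mu]_(x in `[(- L)%R, L]) (plateau l x * two_state eL eR x))%R.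
pose C1 := 2 * eM - eL - eR.
have inI (f : R -> R) : bmeas (`[- L, L]%classic : set R1) f ->
    mu.-integrable `[(- L)%R, L] (EFin \o f).
  exact: bmeas_integrable.
have intY (t : R) : 0 < t -> t <= 1 -> (\int[mu]_(x in `[(- L)%R, L]) Y (x, t))%R =
    cutoff' t * (C0 + C1 * lam * t) + cutoff t * (QL - QR).
  move=> t0 t1; have Jt : `]0, 1]%classic t by rewrite /= in_itv/= t0.
  have sA := bmeas_section1 mI mJ bA Jt.
  have sJ := bmeas_section1 mI mJ bJ Jt.
  have sB := bmeas_section1 mI mJ bB Jt.
  rewrite /Y/= RintegralD//; [|apply: inI; exact: bmeasZ (bmeasD sA sJ)
    |apply: inI; exact: bmeasZ].
  rewrite !RintegralZl//; [|exact: inI|by apply: inI; exact: bmeasD].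
  rewrite Rintegral_plateau'// RintegralD//; [|exact: inI..].
  rewrite Rintegral_cone_jump -?mulrA//.
  by rewrite mulr_ge0 ?(ltW t0)//= (le_trans (ltW (lt_l _ t1)))// lerDl.
have outer : (\int[(mu \x mu)%E]_(p in box) Y p)%R =
    - C0 + 8 / 15 * (QL - QR - C1 * lam).
  rewrite Rintegral_rect21// -Rintegral_cutoff.
  by apply: eq_Rintegral => t /set_mem/=; rewrite in_itv/= => /andP[t0 t1]; exact: intY.
pose A0 c := (\int[mu]_x (`|riemann_data uL uR x - c| * cone_test l (x, 0%R)))%R.
(* At time 0 the same spatial integral C0 appears. *)
have init : A0 k + A0 K = C0.
  have Ei c : A0 c = (\int[mu]_(x in `[(- L)%R, L])
      (plateau l x * two_state `|uL - c| `|uR - c| x))%R.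
    transitivity (\int[mu]_(x in `[(- L)%R, L])
        (`|riemann_data uL uR x - c| * cone_test l (x, 0%R)))%R.
      apply: Rintegral_support => // x _ /=.
      rewrite in_itv/= -ler_norml => /negP; rewrite -ltNge => h.
      by rewrite /cone_test/= plateau_out ?mul0r ?mulr0// ltW.
    apply: eq_Rintegral => x _; rewrite /cone_test/= cutoff0 mulr1 /riemann_data mulrC.
    by congr (_ * _); rewrite /two_state; case: ifP.
  have bE c : bmeas (`[- L, L]%classic : set R1)
      (fun x : R => plateau l x * two_state `|uL - c| `|uR - c| x).
    by apply: bmeasM; [exact: continuous_bmeas|exact: bmeas_two_state].
  rewrite !Ei -RintegralD//; [|exact: inI..].
  apply: eq_Rintegral => x _; rewrite -mulrDr; congr (_ * _).
  by rewrite /two_state; case: ifP.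
have hX c : 0 <= (\int[(mu \x mu)%E]_(p in box) X c p)%R + A0 c.
  have := hent c _ (test_function_cone_test l).
  rewrite -XH; congr (0 <= _ + _).
  apply: eq_Rintegral => p _; rewrite /X.
  by have [_ ->] := is_derive_cone_testx l p; have [_ ->] := is_derive_cone_testy l p.
have hXX : (\int[(mu \x mu)%E]_(p in box) X k p)%R +
    (\int[(mu \x mu)%E]_(p in box) X K p)%R <= - C0 + 8 / 15 * (QL - QR - C1 * lam).
  rewrite -outer -RintegralD//; [|exact: bmeas_integrable..].
  by apply: le_Rintegral => //; apply: bmeas_integrable => //; exact: bmeasD.
have := addr_ge0 (hX k) (hX K); rewrite addrACA init => /le_trans - /(_ _ (lerD hXX (lexx C0))).
by rewrite addrAC addNr add0r pmulr_rge0 ?divr_gt0// subr_ge0 mulrC.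
Qed.
End kruzhkov_cone.

(** * Dissipation of a Riemann problem *)

Section riemann.
Variable R : realType.
Implicit Types (g Phi : R -> R) (uL uR lam k : R).

(** [cone_entropy] with [K = uR] and [K = uL]: then one of the two outer
    values of [|s - k| + |s - K|] is [|K - k|] itself, and the other exceeds it
    by twice the distance of [k] to the other state. *)
Lemma wave_speed_chord g uL uR lam k : wave_speed_bound g uL uR lam ->
  uL <= k <= uR ->
  g uL - lam * (k - uL) <= g k /\ g uR - lam * (uR - k) <= g k.
Proof.
move=> hw /andP[Lk kR].
have sgE x y : x <= y -> Num.sg (y - x) * (g y - g x) = g y - g x.
  rewrite le_eqVlt => /predU1P[->|xy]; first by rewrite !subrr mulr0.
  by rewrite gtr0_sg ?mul1r// subr_gt0.
have sgE' x y : x <= y -> Num.sg (x - y) * (g x - g y) = g y - g x.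
  rewrite le_eqVlt => /predU1P[->|xy]; first by rewrite !subrr mulr0.
  by rewrite ltr0_sg ?subr_lt0// mulN1r opprB.
have LR := le_trans Lk kR.
split.
  have := cone_entropy k uR hw; rewrite /kflux !subrr sgr0 mul0r normr0.
  rewrite (sgE' _ _ Lk) (sgE' _ _ LR) (sgE _ _ kR).
  rewrite (ler0_norm (_ : uL - k <= 0)) ?subr_le0//.
  rewrite (ler0_norm (_ : uL - uR <= 0)) ?subr_le0//.
  by rewrite !ger0_norm ?subr_ge0//; lra.
have := cone_entropy k uL hw; rewrite /kflux !subrr sgr0 mul0r normr0.
rewrite (sgE' _ _ Lk) (sgE _ _ LR) (sgE _ _ kR).
rewrite (ler0_norm (_ : uL - k <= 0)) ?subr_le0//.
by rewrite !ger0_norm ?subr_ge0//; lra.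
Qed.

(** If [u] solves the Riemann problem for [g], then [- u] solves it for the
    flux [fun s => - g (- s)].  This exchanges the order of the two
    states. *)
Lemma wave_speed_bound_opp g uL uR lam : wave_speed_bound g uL uR lam ->
  wave_speed_bound (fun s => - g (- s)) (- uL) (- uR) lam.
Proof.
move=> [lam0 [u [mu_ [M hM] hent] hu]]; split => //; exists (fun p => - u p).
  split.
  - exact: measurableT_comp mu_.
  - by exists M => p /hM; rewrite normrN.
  move=> k psi hpsi; have := hent (- k) psi hpsi; congr (0 <= _ + _).
    apply: eq_Rintegral => p _; rewrite opprK.
    rewrite (_ : - u p - k = - (u p + k)); last by rewrite opprD.
    by rewrite normrN sgrN opprK mulNr -mulrN opprD !opprK addrC.
  apply: eq_Rintegral => x _; rewrite opprK /riemann_data; congr (_ * _).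
  by case: ifP => _; rewrite -[in RHS]normrN opprD !opprK.
by move=> x t t0; have [h1 h2] := hu x t t0; split => [/h1|/h2] ->.
Qed.

(** Integrated form of an affine lower bound on [g]. *)
Lemma primitive_ge_quadratic g Phi (A B a b : R) : a <= b ->
  (forall x : R, is_derive x 1 Phi (g x)) ->
  (forall s, a <= s <= b -> A + B * s <= g s) ->
  A * (b - a) + B * (b ^+ 2 - a ^+ 2) / 2 <= Phi b - Phi a.
Proof.
move=> ab dPhi hg.
pose F (x : R) : R := Phi x - (A * x + B / 2 * x ^+ 2).
have dF (x : R) : is_derive x 1 F (g x - (A + B * x)).
  by rewrite /F; apply: is_derive_eq; rewrite /GRing.scale/=; field.
have cF : {within `[a, b], continuous F}.
  by apply: continuous_subspaceT; exact: derive_continuous dF.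
have [c + hF] := MVT_segment ab (fun x _ => dF x) cF.
rewrite in_itv/= => /hg hc.
have : 0 <= F b - F a by rewrite hF mulr_ge0// subr_ge0.
by rewrite /F; lra.
Qed.

(** For [uL <= uR] the chord bounds give two affine lower bounds on [g],
    one starting from [uL] with slope [- d] and one arriving at [uR] with slope
    [d].  Each is integrated on the side of their crossing point where it is
    the larger one. *)
Lemma riemann_dissipation g Phi uL uR lam d (D := uR - uL)
    (E := D * g uR - (Phi uR - Phi uL) - d * D ^+ 2 / 2) :
  wave_speed_bound g uL uR lam -> lam <= d ->
  (forall x : R, is_derive x 1 Phi (g x)) ->
  E <= 0 /\ (d * D - (g uR - g uL)) ^+ 2 <= - (4 * d * E).
Proof.
rewrite {}/E {}/D; wlog : g Phi uL uR / uL <= uR.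
  move=> hwlog; have [|/ltW RL] := leP uL uR; first exact: hwlog.
  move=> hw lamd dPhi.
  have := hwlog (fun s => - g (- s)) (fun s => Phi (- s)) (- uL) (- uR).
  rewrite lerN2 !opprK => /(_ RL (wave_speed_bound_opp hw) lamd) [|h1 h2].
    move=> x; rewrite -mulrN1.
    by apply: (@is_derive1_comp _ Phi (fun s => - s)).
  by split; [apply: le_trans h1|apply: le_trans (le_trans h2 _)];
    rewrite le_eqVlt; apply/orP; left; apply/eqP; field.
move=> LR hw lamd dPhi.
have [lam0 _] := hw.
have chord k : uL <= k <= uR ->
    g uL - d * (k - uL) <= g k /\ g uR - d * (uR - k) <= g k.
  move=> hk; have [h1 h2] := wave_speed_chord hw hk; case/andP: hk => h3 h4.
  split; [apply: le_trans h1|apply: le_trans h2]; rewrite lerD2l lerN2;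
  by rewrite ler_wpM2r// subr_ge0.
have [hR _] := chord uR ltac:(by rewrite lexx LR).
have [_ hL] := chord uL ltac:(by rewrite lexx LR).
set r := d * (uR - uL) - (g uR - g uL).
(* [uL + y] is the point where the two affine bounds cross. *)
have [y [y0 yD ry]] : exists y, [/\ 0 <= y, y <= uR - uL & r = 2 * d * y].
  move: (le_trans lam0 lamd); rewrite le_eqVlt => /predU1P[d0|d0].
    by exists 0; rewrite lexx subr_ge0 LR /r; split => //; move: hR hL; rewrite -d0; lra.
  exists (r / (2 * d)); split; last by field; lra.
  - by rewrite divr_ge0//; rewrite /r; lra.
  - by rewrite ler_pdivrMr; rewrite /r; lra.
have h1 : (g uL + d * uL) * (uL + y - uL) + (- d) * ((uL + y) ^+ 2 - uL ^+ 2) / 2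
    <= Phi (uL + y) - Phi uL.
  apply: (primitive_ge_quadratic (g := g)) => //; first by rewrite lerDl.
  move=> s /andP[s1 s2]; have [] := chord s; last by lra.
  by rewrite s1 (le_trans s2)//; lra.
have h2 : (g uR - d * uR) * (uR - (uL + y)) + d * (uR ^+ 2 - (uL + y) ^+ 2) / 2
    <= Phi uR - Phi (uL + y).
  apply: (primitive_ge_quadratic (g := g)) => //; first by lra.
  move=> s /andP[s1 s2]; have [] := chord s; last by lra.
  by rewrite s2 andbT (le_trans _ s1)//; lra.
have h3 : (uR - uL) * g uR - (Phi uR - Phi uL) - d * (uR - uL) ^+ 2 / 2
   <= - (d * y ^+ 2).
  have dE : g uR = g uL + d * (uR - uL) - 2 * d * y by rewrite -ry /r; ring.
  move: h1 h2; rewrite dE; lra.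
have d0 := le_trans lam0 lamd; split.
  by apply: le_trans h3 _; rewrite oppr_le0 mulr_ge0// sqr_ge0.
have : 4 * d * (- (- (d * y ^+ 2))) <= 4 * d * - ((uR - uL) * g uR - (Phi uR - Phi uL) - d * (uR - uL) ^+ 2 / 2).
  by rewrite ler_wpM2l ?lerN2//; lra.
by rewrite ry; lra.
Qed.

(** The integral is taken from a point [- (|x| + 1)] depending on [x], in order
    that the base point always lies to the left of [x]; near a given point the
    value agrees with the integral from one fixed base point. *)
Lemma continuous_primitive (f : R -> R) : continuous f ->
  exists F, forall x : R, is_derive x 1 F (f x).
Proof.
move=> cf; pose mu := @lebesgue_measure R.
have ii (x y : R) (b1 b2 : bool) :
    mu.-integrable [set` Interval (BSide b1 x) (BSide b2 y)] (EFin \o f).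
  apply: bmeas_integrable => //; first exact: mu_itv_lty.
  apply: bmeasS (continuous_bmeas x y cf) => // t /=.
  by apply: subset_itv; rewrite bnd_simp; case: b1 b2 => -[].
have split_int (B A x : R) : B <= A -> A <= x ->
    (\int[mu]_(t in `[A, x]) f t = \int[mu]_(t in `[B, x]) f t - \int[mu]_(t in `[B, A]) f t)%R.
  by move=> BA Ax; rewrite Rintegral_itvB ?bnd_simp// Rintegral_itv_obnd_cbnd.
pose o : R := 0.
pose F (x : R) : R := (\int[mu]_(t in `[- (`|x| + 1), x]) f t -
  \int[mu]_(t in `[- (`|x| + 1), o]) f t)%R.
exists F => x0; pose B := - (`|x0| + 2).
have Bx0 : B < x0 by have := ler_norm (- x0); rewrite normrN /B; lra.
have [d1 d2] := continuous_FTC1_closed (ltr_pwDr ltr01 (lexx x0)) (ii B (x0 + 1) true false) Bx0 (cf x0).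
have d : is_derive x0 1 (fun x => \int[mu]_(t in `[B, x]) f t - \int[mu]_(t in `[B, o]) f t)%R (f x0).
  rewrite -[f x0]subr0; apply: is_deriveB.
  by split; [exact: d1|rewrite -d2 derive1E].
apply: near_eq_is_derive d; near=> x.
have xx1 : `|x - x0| <= 1.
  near: x; apply/nbhs_ballP; exists 1 => //= y; rewrite /ball/= distrC.
  by move=> /ltW.
have xx0 : `|x| <= `|x0| + 1 by have := lerB_dist x x0; lra.
have xA : - (`|x| + 1) <= x by have := ler_norm (- x); rewrite normrN; lra.
have A0 : - (`|x| + 1) <= o by have := normr_ge0 x; rewrite /o; lra.
have BA : B <= - (`|x| + 1) by rewrite /B; lra.
by rewrite /F (split_int B (- (`|x| + 1)) x)// (split_int B (- (`|x| + 1)) o)//; ring.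
Unshelve. all: by end_near. Qed.

End riemann.

(** * Sections of convex cells *)

Section convex_sections.
Variable R : realType.
Implicit Types (K : set (R * R)) (p q z : R * R).

(** Convexity in coordinates, which is symmetric in the two axes and thus
    lets horizontal and vertical lines be treated alike. *)
Definition plane_convex K := forall p q (t : R), 0 <= t <= 1 -> K p -> K q ->
  K ((1 - t) * p.1 + t * q.1, (1 - t) * p.2 + t * q.2).

Lemma interior_boxP K p : K° p <->
  exists2 e : R, 0 < e & forall q, `|q.1 - p.1| < e -> `|q.2 - p.2| < e -> K q.
Proof.
split => [/nbhs_ballP[e /= e0 he]|[e e0 he]].
  exists e => // q h1 h2; apply: he.
  by split; rewrite /ball/= distrC.
apply/nbhs_ballP; exists e => //= q [h1 h2].
by apply: he; rewrite distrC.
Qed.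

(** The dilation of centre [p] and ratio [1 - t] maps a neighbourhood of [z]
    inside [K] onto a neighbourhood of the point of the segment. *)
Lemma interior_segment K z p (t : R) : plane_convex K -> K° z -> K p ->
  0 <= t < 1 -> K° ((1 - t) * z.1 + t * p.1, (1 - t) * z.2 + t * p.2).
Proof.
move=> cK /interior_boxP[e e0 he] Kp /andP[t0 t1].
have t1' : 0 < 1 - t by lra.
apply/interior_boxP; exists ((1 - t) * e); first by rewrite mulr_gt0.
move=> q /= h1 h2.
pose z' := (z.1 + (q.1 - ((1 - t) * z.1 + t * p.1)) / (1 - t),
            z.2 + (q.2 - ((1 - t) * z.2 + t * p.2)) / (1 - t)).
have Kz' : K z'.
  apply: he; rewrite /z'/= addrAC subrr add0r normrM normfV (gtr0_norm t1').
    by rewrite ltr_pdivrMr// [ltRHS]mulrC.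
  by rewrite ltr_pdivrMr// [ltRHS]mulrC.
have := cK z' p t _ Kz' Kp; rewrite t0 ltW// => /(_ isT).
rewrite /z'/=; congr K; rewrite [RHS]surjective_pairing; congr pair; field;
  by rewrite gt_eqF.
Qed.

Definition swap_set K : set (R * R) := [set p | K (p.2, p.1)].

Lemma interior_swap K (x y : R) : (swap_set K)° (x, y) <-> K° (y, x).
Proof.
by split => /interior_boxP[e e0 he]; apply/interior_boxP; exists e => // q h1 h2;
  [have := he (q.2, q.1) h2 h1; rewrite /swap_set/= -surjective_pairing
  |exact: (he (q.2, q.1))].
Qed.

Lemma plane_convex_swap K : plane_convex K -> plane_convex (swap_set K).
Proof. by move=> cK p q t t01 Kp Kq; apply: (cK (p.2, p.1) (q.2, q.1)). Qed.

Lemma at_most_one (P : set R) : (forall x y, P x -> P y -> ~ x < y) ->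
  exists c, forall x, P x -> x = c.
Proof.
move=> uP; have [[c Pc]|nP] := pselect (exists c, P c).
  exists c => x Px; have [xc|cx|//] := ltgtP x c.
    by have := uP _ _ Px Pc.
  by have := uP _ _ Pc Px.
by exists 0 => x Px; case: nP; exists x.
Qed.

(** By [interior_segment], a point of the section outside the interior of [K]
    cannot lie strictly between [x0] and another point of the section. So there
    is at most one on each side of [x0]. *)
Lemma convex_line_skeleton K (y x0 : R) : plane_convex K -> K° (x0, y) ->
  exists s : seq R, forall x, x \notin s -> K (x, y) -> K° (x, y).
Proof.
move=> cK iK.
(* A point strictly between x0 and a point of the section is interior. *)
have key x x' : K (x', y) -> x0 < x < x' \/ x' < x < x0 -> K° (x, y).
  move=> Kx' h; pose t := (x - x0) / (x' - x0).
  have d0 : x' - x0 != 0 by rewrite subr_eq0; case: h => /andP[h1 h2];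
    [rewrite gt_eqF// (lt_trans h1)|rewrite lt_eqF// (lt_trans h1)].
  have t01 : 0 <= t < 1.
    case: h => /andP[h1 h2].
      have d1 : 0 < x' - x0 by lra.
      by rewrite /t divr_ge0//= ?ltr_pdivrMr//; lra.
    have d1 : x' - x0 < 0 by lra.
    by rewrite /t ltr_ndivrMr// mulr_le0 ?invr_le0//=; lra.
  have := interior_segment cK iK Kx' t01; congr (_ _).
  by rewrite /t/=; congr pair; [field|ring].
have [c1 h1] := @at_most_one [set x | [/\ x0 < x, K (x, y) & ~ K° (x, y)]]
  ltac:(by move=> x x' [g1 _ nx] [g2 Kx' _] xx'; apply: nx; apply: (key _ _ Kx'); left; rewrite g1).
have [c2 h2] := @at_most_one [set x | [/\ x < x0, K (x, y) & ~ K° (x, y)]]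
  ltac:(by move=> x x' [g1 Kx _] [g2 _ nx'] xx'; apply: nx'; apply: (key _ _ Kx); right; rewrite g2 andbT).
exists [:: c1; c2] => x; rewrite !inE negb_or => /andP[xc1 xc2] Kx.
apply: contrapT => nx; have [xx0|xx0|E] := ltgtP x x0.
- by move/eqP: xc2; apply; apply: h2.
- by move/eqP: xc1; apply; apply: h1.
- by apply: nx; rewrite E.
Qed.

(** The lines that meet [K] but not its interior are excluded: by
    [interior_segment] there is at most one on each side of a given interior
    point. *)
Lemma convex_skeleton K : plane_convex K -> K° !=set0 ->
  exists s : seq R, forall y, y \notin s ->
    exists s' : seq R, forall x, x \notin s' -> K (x, y) -> K° (x, y).
Proof.
move=> cK [z iz].
(* Heights of the lines that touch K without entering its interior. *)
pose B : set R := [set y | (exists x, K (x, y)) /\ forall x, ~ K° (x, y)].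
(* A line strictly between z and a point of K meets the interior. *)
have key y y' : (exists x, K (x, y')) -> z.2 < y < y' \/ y' < y < z.2 -> exists x, K° (x, y).
  move=> [x' Kx'] h; pose t := (y - z.2) / (y' - z.2).
  have d0 : y' - z.2 != 0 by rewrite subr_eq0; case: h => /andP[h1 h2];
    [rewrite gt_eqF// (lt_trans h1)|rewrite lt_eqF// (lt_trans h1)].
  have t01 : 0 <= t < 1.
    case: h => /andP[h1 h2].
      have d1 : 0 < y' - z.2 by lra.
      by rewrite /t divr_ge0//= ?ltr_pdivrMr//; lra.
    have d1 : y' - z.2 < 0 by lra.
    by rewrite /t ltr_ndivrMr// mulr_le0 ?invr_le0//=; lra.
  exists ((1 - t) * z.1 + t * x').
  have := interior_segment cK iz Kx' t01; congr (_ _).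
  by rewrite /t/=; congr pair; field.
have [c1 h1] := @at_most_one [set y | z.2 < y /\ B y]
  ltac:(by move=> y y' [g1 [_ nx]] [g2 [Kx' _]] xx';
     have [|x /nx] := key y y' Kx' _ => //; left; rewrite g1).
have [c2 h2] := @at_most_one [set y | y < z.2 /\ B y]
  ltac:(by move=> y y' [g1 [Kx _]] [g2 [_ nx']] xx';
     have [|x /nx'] := key y' y Kx _ => //; right; rewrite g2 andbT).
exists [:: c1; c2] => y; rewrite !inE negb_or => /andP[yc1 yc2].
have [[x0 hx0]|nx0] := pselect (exists x0, K° (x0, y)).
  exact: convex_line_skeleton hx0.
exists [::] => x _ Kx; exfalso.
have By : B y by split; [exists x|move=> x1 hx1; apply: nx0; exists x1].
have [yz|yz|E] := ltgtP y z.2.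
- by move/eqP: yc2; apply; apply: h2.
- by move/eqP: yc1; apply; apply: h1.
- by apply: nx0; exists z.1; rewrite E -surjective_pairing.
Qed.

Lemma convex_family_skeleton (N : nat) (K : 'I_N -> set (R * R)) :
  (forall k, plane_convex (K k)) -> (forall k, (K k)° !=set0) ->
  exists s : seq R, forall y, y \notin s ->
    exists s' : seq R, forall x, x \notin s' ->
      forall k, K k (x, y) -> (K k)° (x, y).
Proof.
move=> cK iK; have [s hs] := choice (fun k => convex_skeleton (cK k) (iK k)).
exists (flatten [seq s k | k <- enum 'I_N]) => y /flatten_mapP ys.
have ysk k : y \notin s k.
  by apply/negP => yk; apply: ys; exists k => //; rewrite mem_enum.
have [s' hs'] := choice (fun k => hs k y (ysk k)).
exists (flatten [seq s' k | k <- enum 'I_N]) => x /flatten_mapP xs k.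
by apply: hs'; apply/negP => xk; apply: xs; exists k => //; rewrite mem_enum.
Qed.

End convex_sections.

(** * Piecewise smooth functions on the mesh *)

Section fe_functions.
Variable R : realType.
Implicit Types (p q e : R * R) (f g v w Q : R * R -> R).
Notation mu := (@lebesgue_measure R).
Notation R1 := (measurableTypeR R).
Notation R2 := (measurableTypeR R * measurableTypeR R)%type.

Definition C1fun Q : Prop := continuous Q /\ forall e, exists2 Q' : R * R -> R,
  continuous Q' & forall p, is_derive p e Q (Q' p).

Lemma C1_cst (r : R) : C1fun (fun=> r).
Proof.
split; first exact: contC; move=> e; exists (fun=> 0); first exact: contC.
by move=> p; exact: is_derive_cst.
Qed.

Lemma C1D f g : C1fun f -> C1fun g -> C1fun (fun p => f p + g p).
Proof.
move=> [cf df] [cg dg]; split; first exact: contD.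
move=> e; have [f' cf' hf] := df e; have [g' cg' hg] := dg e.
exists (fun p => f' p + g' p); first exact: contD.
by move=> p; apply: is_deriveD.
Qed.

Lemma C1M f g : C1fun f -> C1fun g -> C1fun (fun p => f p * g p).
Proof.
move=> [cf df] [cg dg]; split; first exact: contM.
move=> e; have [f' cf' hf] := df e; have [g' cg' hg] := dg e.
exists (fun p => f p * g' p + g p * f' p).
  by apply: contD; exact: contM.
by move=> p; apply: is_deriveM.
Qed.

Lemma C1X f n : C1fun f -> C1fun (fun p => f p ^+ n).
Proof.
move=> hf; elim: n => [|n IH]; first exact: C1_cst.
under eq_fun do rewrite exprS.
exact: C1M.
Qed.

Lemma C1_sum (J : Type) (s : seq J) (F : J -> R * R -> R) :
  (forall j, C1fun (F j)) -> C1fun (fun p => \sum_(j <- s) F j p).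
Proof.
move=> hF; elim: s => [|j s IH].
  by under eq_fun do rewrite big_nil; exact: C1_cst.
by under eq_fun do rewrite big_cons; exact: C1D.
Qed.

Lemma C1_fst : C1fun fst.
Proof.
split=> [p|e]; first exact: cvg_fst.
exists (fun=> e.1) => [|p]; first exact: contC.
apply/is_derive_lineP => /=.
by apply: is_derive_eq; rewrite /GRing.scale/=; ring.
Qed.

Lemma C1_snd : C1fun snd.
Proof.
split=> [p|e]; first exact: cvg_snd.
exists (fun=> e.2) => [|p]; first exact: contC.
apply/is_derive_lineP => /=.
by apply: is_derive_eq; rewrite /GRing.scale/=; ring.
Qed.

Lemma C1_eval2 (q : {poly {poly R}}) f g : C1fun f -> C1fun g ->
  C1fun (fun p => eval2 q (f p, g p)).
Proof.
move=> hf hg.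
have -> : (fun p => eval2 q (f p, g p)) = (fun p => \sum_(i <- index_enum 'I_(size q))
    (\sum_(j <- index_enum 'I_(size q`_i)) (q`_i)`_j * f p ^+ j) * g p ^+ i).
  apply/funext => p; rewrite /eval2/= [q.[_]]horner_coef horner_sum; apply: eq_bigr => i _.
  by rewrite hornerM horner_exp hornerC [(q`_i).[_]]horner_coef.
apply: C1_sum => i; apply: C1M; last exact: C1X.
by apply: C1_sum => j; apply: C1M; [exact: C1_cst|exact: C1X].
Qed.

(** Cramer's rule. *)
Lemma affine_iso_inverse (T : R * R -> R * R) : affine_iso T ->
  exists S1 S2, [/\ C1fun S1, C1fun S2 & forall p, (S1 (T p), S2 (T p)) = p].
Proof.
move=> [r1 [r2 [t [d0 TE]]]]; set det := (X in X != 0) in d0.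
exists (fun p => (r2.2 * (p.1 + - t.1) + - r1.2 * (p.2 + - t.2)) * det^-1).
exists (fun p => (r1.1 * (p.2 + - t.2) + - r2.1 * (p.1 + - t.1)) * det^-1).
have C1s (x y x' y' : R) : C1fun (fun p => (x * (p.1 + y) + x' * (p.2 + y')) * det^-1).
  apply: C1M; last exact: C1_cst.
  by apply: C1D; apply: C1M; first exact: C1_cst; 
    [|exact: C1_cst|]; apply: C1D; (exact: C1_cst || exact: C1_fst || exact: C1_snd).
split => //.
  have := C1s (- r2.1) (- t.1) r1.1 (- t.2).
  by congr C1fun; apply/funext => p; rewrite addrC.
move=> p; rewrite TE /dot2/= [RHS]surjective_pairing; congr pair;
  by rewrite /det; field; rewrite -/det.
Qed.

Lemma affine_iso_convex (T : R * R -> R * R) (A : set (R * R)) :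
  affine_iso T -> @convex_set R (R * R)%type A -> plane_convex (T @` A).
Proof.
move=> [r1 [r2 [t [_ TE]]]] cA _ _ s /andP[s0 s1] [p Ap <-] [q Aq <-].
have := cA q p (Itv01 s0 s1) (mem_set Aq) (mem_set Ap) => /set_mem h.
exists ((1 - s) * p.1 + s * q.1, (1 - s) * p.2 + s * q.2).
  move: h; congr A; rewrite [LHS]surjective_pairing; congr pair;
  by rewrite addrC.
by rewrite !TE /dot2/=; congr pair; ring.
Qed.

End fe_functions.

Section piecewise.
Context (R : realType) (a b : R) (Th : fe_mesh R).
Implicit Types (p q e : R * R) (f g v w Q : R * R -> R).
Notation mu := (@lebesgue_measure R).
Notation R1 := (measurableTypeR R).
Notation R2 := (measurableTypeR R * measurableTypeR R)%type.

(** Contains the finite element space and, unlike it, is stable under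
    products: the square of a finite element function is needed in the energy
    estimate. *)
Definition pwC1 v : Prop := {within square a b, continuous v} /\
  forall k : 'I_(ncell Th), exists2 Q, C1fun Q & forall p, cell k p -> v p = Q p.

Definition cells_int : set (R * R) :=
  \bigcup_(k in [set: 'I_(ncell Th)]) (cell k)°.

Lemma open_cells_int : open cells_int.
Proof. by apply: bigcup_open => k _; exact: open_interior. Qed.

Lemma Vh_pwC1 v : (forall k : 'I_(ncell Th), affine_iso (cell_map k)) ->
  Vh a b Th v -> pwC1 v.
Proof.
move=> aff [cv _ pv]; split => // k.
have [alpha ha] := pv k; have [S1 [S2 [C1 C2 SK]]] := affine_iso_inverse (aff k).
exists (fun p => \sum_(l <- index_enum 'I_(nloc Th)) alpha l * eval2 (ref_poly l) (S1 p, S2 p)).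
  by apply: C1_sum => l; apply: C1M; [exact: C1_cst|exact: C1_eval2].
by move=> _ [p rp <-]; rewrite ha// SK.
Qed.

Lemma pwC1M v w : pwC1 v -> pwC1 w -> pwC1 (fun p => v p * w p).
Proof.
move=> [cv hv] [cw hw]; split; first exact: (@contM R (subspace (square a b))).
move=> k; have [Q hQ vQ] := hv k; have [P hP wP] := hw k.
by exists (fun p => Q p * P p) => [|p kp]; [exact: C1M|rewrite vQ// wP].
Qed.

(** Near an interior point of a cell, the cellwise derivative is the
    derivative of the smooth function representing [v] on that cell. *)
Lemma pw_near v e (k : 'I_(ncell Th)) p : pwC1 v -> (cell k)° p -> exists Q' : R * R -> R,
  [/\ continuous Q', forall p', (cell k)° p' -> is_derive p' e v (Q' p') &
      \forall p' \near p, dpart Th e v p' = Q' p'].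
Proof.
move=> [_ hv] kp; have [Q [_ /(_ e)[Q' cQ' dQ]] vQ] := hv k.
have H p' : (cell k)° p' -> is_derive p' e v (Q' p').
  move=> kp'; apply: near_eq_is_derive (dQ p').
  by apply: filterS kp' => z kz; rewrite vQ.
exists Q'; split => //.
have : \forall p' \near p, (cell k)° p'.
  by apply: open_nbhs_nbhs; split => //; exact: open_interior.
apply: filterS => p' kp'; rewrite /dpart mem_set; last by exists k.
by have [_ ->] := H p' kp'.
Qed.

Lemma is_derive_dpart v e p : pwC1 v -> cells_int p ->
  is_derive p e v (dpart Th e v p).
Proof.
move=> hv [k _ kp]; have [Q' [_ + /nbhs_singleton ->]] := pw_near e hv kp.
exact.
Qed.

Lemma continuous_dpart v e p : pwC1 v -> cells_int p ->
  {for p, continuous (dpart Th e v)}.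
Proof.
move=> hv [k _ kp]; have [Q' [cQ' _ hQ']] := pw_near e hv kp.
apply: near_continuous (cQ' p).
by apply: filterS hQ' => p' ->.
Qed.

Lemma continuous_pwC1 v p : pwC1 v -> cells_int p -> {for p, continuous v}.
Proof.
move=> [_ hv] [k _ kp]; have [Q [cQ _] vQ] := hv k.
apply: near_continuous (cQ p).
by apply: filterS kp => p' kp'; rewrite vQ.
Qed.

Lemma dpart_out v e p : ~ cells_int p -> dpart Th e v p = 0.
Proof. by move=> np; rewrite /dpart memNset. Qed.

Lemma squareE : square a b = (`[a, b] `*` `[a, b])%classic.
Proof.
apply/seteqP; split => p /=; rewrite /square/= !in_itv/=; first by move=> /andP.
by move=> /andP.
Qed.

Lemma measurable_square : measurable (square a b : set R2).
Proof. by rewrite squareE; exact: measurable_rect. Qed.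

Lemma square_lty : ((mu \x mu) (square a b) < +oo)%E.
Proof. by rewrite squareE leb2_rect_lty//; exact: mu_itv_lty. Qed.

Lemma compact_square : compact (square a b).
Proof. by rewrite squareE; apply: compact_setX; exact: segment_compact. Qed.

Lemma within_square_bmeas f : {within square a b, continuous f} ->
  bmeas (square a b : set R2) f.
Proof.
move=> cf; split; first exact: continuous_measurable_fun2 measurable_square cf.
have /compact_bounded[M [_ hM]] : compact (f @` square a b).
  by apply: continuous_compact => //; exact: compact_square.
by exists (M + 1) => x xab; apply: (hM (M + 1)); [rewrite ltrDl|exists x].
Qed.

Lemma pwC1_bmeas v : pwC1 v -> bmeas (square a b : set R2) v.
Proof. by move=> [cv _]; exact: within_square_bmeas. Qed.

Lemma dpart_bmeas v e : (forall k : 'I_(ncell Th), cell k `<=` square a b) ->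
  pwC1 v -> bmeas (square a b : set R2) (dpart Th e v).
Proof.
move=> cellS hv; split.
  have mO : measurable (cells_int : set R2).
    by apply: open_measurable2; exact: open_cells_int.
  have -> : dpart Th e v = dpart Th e v \_ cells_int.
    apply/funext => p; rewrite patchE; case: ifPn => // /negP np.
    by rewrite dpart_out// => Op; apply: np; rewrite inE.
  apply: measurable_funTS; apply/(measurable_restrictT _ mO).
  apply: continuous_measurable_fun2 => //.
  rewrite continuous_open_subspace; last exact: open_cells_int.
  by move=> p /set_mem Op; exact: continuous_dpart.
have hb (k : 'I_(ncell Th)) : exists M, 0 <= M /\ forall p, (cell k)° p -> `|dpart Th e v p| <= M.
  have [_ /(_ k)[Q [_ /(_ e)[Q' cQ' dQ]] vQ]] := hv.
  have [_ [M hM]] := within_square_bmeas (continuous_subspaceT cQ').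
  exists `|M|; split => // p kp; apply: le_trans (ler_norm M).
  have d : is_derive p e v (Q' p).
    apply: near_eq_is_derive (dQ p).
    by apply: filterS kp => z kz; rewrite vQ.
  rewrite /dpart mem_set; last by exists k.
  have [_ ->] := d; apply: hM; apply: cellS.
  exact: interior_subset kp.
have [M hM] := choice hb; exists (\sum_k M k) => p _.
have [[k _ kp]|np] := pselect (cells_int p); last first.
  by rewrite dpart_out// normr0 sumr_ge0// => k _; have [] := hM k.
rewrite (bigD1 k)//=; have [_ /(_ _ kp) h] := hM k.
by rewrite (le_trans h)// lerDl sumr_ge0// => j _; have [] := hM j.
Qed.

Lemma dpart_sum (I : nat) (phi : 'I_I -> R * R -> R) (V : 'I_I -> R) e p :
  (forall i, pwC1 (phi i)) ->
  dpart Th e (fe_fun phi V) p = \sum_i V i * dpart Th e (phi i) p.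
Proof.
move=> hphi; have [Op|np] := pselect (cells_int p); last first.
  by rewrite dpart_out// big1// => i _; rewrite dpart_out// mulr0.
rewrite {1}/dpart mem_set//.
suff h : is_derive p e (fe_fun phi V) (\sum_i V i * dpart Th e (phi i) p).
  by have [_ ->] := h.
rewrite (_ : fe_fun phi V = \sum_(i < I) (fun p => V i * phi i p)); last first.
  by apply/funext => q; rewrite /fe_fun fct_sumE.
by apply: is_derive_sum => i; apply: is_deriveZ; exact: is_derive_dpart.
Qed.

Lemma dpart_sqr v e p : pwC1 v ->
  dpart Th e (fun p => v p * v p) p = 2 * (dpart Th e v p * v p).
Proof.
move=> hv; have [Op|np] := pselect (cells_int p); last first.
  by rewrite !dpart_out// mul0r mulr0.
rewrite {1}/dpart mem_set//.
have h : is_derive p e (fun p => v p * v p) (2 * (dpart Th e v p * v p)).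
  have d := is_derive_dpart e hv Op.
  have -> : 2 * (dpart Th e v p * v p) = v p * dpart Th e v p + v p * dpart Th e v p by ring.
  exact: is_deriveM.
by have [_ ->] := h.
Qed.

End piecewise.

(** * Gauss formula on the periodic square *)

Section gauss.
Context (R : realType) (a b sigma : R) (Th : fe_mesh R).
Implicit Types (p q e : R * R) (f g v w Q : R * R -> R).
Notation mu := (@lebesgue_measure R).
Notation R1 := (measurableTypeR R).
Notation R2 := (measurableTypeR R * measurableTypeR R)%type.

Lemma Rintegral_finite_support (A : set R) (f : R -> R) (s : seq R) :
  measurable A -> (forall x, A x -> x \notin s -> f x = 0) ->
  (\int[mu]_(x in A) f x)%R = 0.
Proof.
move=> mA f0.
transitivity (\int[mu]_(x in A `&` [set` s]) f x)%R.
  apply: Rintegral_support => [x []//|x Ax nx]; apply: f0 => //.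
  by apply/negP => xs; exact: nx.
have cs (B : set R) : B `<=` [set` s] -> countable B.
  by move=> Bs; apply: finite_set_countable; apply: sub_finite_set Bs (finite_seq s).
rewrite /Rintegral null_set_integral//.
- by apply: countable_measurable => //; apply: cs => x [].
- by move=> _ Y _; apply: countable_measurable => //; apply: cs => x [[]].
- by apply: countable_lebesgue_measure0; apply: cs => x [].
Qed.

Hypothesis hab : a < b.
Hypothesis hTh : is_mesh a b sigma Th.

Lemma mesh_aff (k : 'I_(ncell Th)) : affine_iso (cell_map k).
Proof. by have [_ + _ _ _] := hTh; apply. Qed.

Lemma mesh_sub (k : 'I_(ncell Th)) : cell k `<=` square a b.
Proof. by have [_ _ <- _ _] := hTh => p kp; exists k. Qed.

Lemma mesh_cover p : square a b p -> exists k : 'I_(ncell Th), cell k p.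
Proof. by have [_ _ <- _ _] := hTh => -[k _ kp]; exists k. Qed.

Lemma mesh_convex (k : 'I_(ncell Th)) : plane_convex (cell k).
Proof.
have [[_ cv _] _ _ _ _] := hTh; apply: affine_iso_convex cv.
exact: mesh_aff.
Qed.

(** Half the radius of the disc given by shape regularity is the half-side of
    a square contained in the disc. *)
Lemma mesh_interior (k : 'I_(ncell Th)) : (cell k)° !=set0.
Proof.
have [_ _ _ _ /(_ k)[z [r [r0 hz _]]]] := hTh.
exists z; apply/interior_boxP; exists (r / 2); first by rewrite divr_gt0.
move=> q h1 h2; apply: hz => /=.
rewrite -(ger0_norm (ltW r0)) -sqrtr_sqr; apply: ler_wsqrtr.
rewrite /dot2/=; move: h1 h2; rewrite !ltr_norml => /andP[h1 h1'] /andP[h2 h2'].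
nra.
Qed.

(** [iota] parametrizes a line of direction [e] with unit speed. *)
Lemma line_integral_dpart v e (iota : R -> R * R) (s : seq R) :
  pwC1 a b Th v -> (forall h x, iota (h + x) = h *: e + iota x) ->
  continuous iota -> (forall x, a <= x <= b -> square a b (iota x)) ->
  (forall x, x \notin s -> forall k : 'I_(ncell Th), cell k (iota x) ->
     (cell k)° (iota x)) ->
  bmeas (`[a, b]%classic : set R1) (fun x => dpart Th e v (iota x)) ->
  (\int[mu]_(x in `[a, b]) dpart Th e v (iota x))%R = v (iota b) - v (iota a).
Proof.
move=> hv hi ci si hs bm.
apply: (@FTC_piecewise _ (v \o iota) _ s) => //; first exact: ltW.
  have [/subspace_continuousP cv _] := hv.
  apply/subspace_continuousP => x; rewrite /= in_itv/= => xab W /= hW.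
  have /= := cv _ (si _ xab) _ hW => /ci.
  move=> hW'; rewrite /from_subspace.
  have : nbhs x (fun t => square a b (iota t) -> W (v (iota t))) by exact: hW'.
  have sub : (fun t => square a b (iota t) -> W (v (iota t))) `<=`
     (fun t => `[a, b]%classic t -> W (v (iota t))).
    by move=> t ht; rewrite /= in_itv/= => /si/ht.
  by move=> /(filterS sub).
move=> x /andP[ax xb] xs.
have Ox : cells_int Th (iota x).
  have [|k kx] := @mesh_cover (iota x); first by apply: si; rewrite !ltW.
  by exists k => //; exact: hs.
split.
  apply/is_derive_lineP.
  have /is_derive_lineP := is_derive_dpart e hv Ox.
  congr is_derive; apply/funext => h /=.
  by rewrite -hi [h *: 1]mulr1.
exact: (cvg_comp _ _ (ci x) (continuous_dpart hv Ox)).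
Qed.

Lemma gauss_x v : pwC1 a b Th v ->
  (forall y, a <= y <= b -> v (a, y) = v (b, y)) ->
  (\int[(mu \x mu)%E]_(p in square a b) dx Th v p)%R = 0.
Proof.
move=> hv per.
have bd := dpart_bmeas (ex2 R) mesh_sub hv.
have mI : measurable (`[a, b]%classic : set R1) by [].
rewrite squareE in bd *.
rewrite Rintegral_rect21//; try exact: mu_itv_lty.
have [s hs] := convex_family_skeleton mesh_convex mesh_interior.
apply: (Rintegral_finite_support (s := s)) => // y /=; rewrite in_itv/= => yab ys.
have [s' hs'] := hs _ ys.
rewrite (@line_integral_dpart _ (ex2 R) (fun x => (x, y)) s')//.
- by rewrite per// subrr.
- by move=> h x; congr pair; rewrite /=; [rewrite [h *: 1]mulr1|rewrite [h *: 0]mulr0 add0r].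
- by move=> x; exact: (cvg_pair (@cvg_id _ (nbhs x)) (cvg_cst y)).
- by move=> x xab; rewrite /square/= xab.
- by apply: bmeas_section1 bd _ => //=; rewrite in_itv.
Qed.

(** Same argument as [gauss_x], applied to the cells with exchanged
    coordinates. *)
Lemma gauss_y v : pwC1 a b Th v ->
  (forall x, a <= x <= b -> v (x, a) = v (x, b)) ->
  (\int[(mu \x mu)%E]_(p in square a b) dy Th v p)%R = 0.
Proof.
move=> hv per.
have bd := dpart_bmeas (ey2 R) mesh_sub hv.
have mI : measurable (`[a, b]%classic : set R1) by [].
rewrite squareE in bd *.
rewrite Rintegral_rect12//; try exact: mu_itv_lty.
have swap_interior (k : 'I_(ncell Th)) : (swap_set (cell k))° !=set0.
  have [[x y] hz] := @mesh_interior k.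
  by exists (y, x); apply/interior_swap.
have [s hs] := convex_family_skeleton
  (fun k => plane_convex_swap (@mesh_convex k)) swap_interior.
apply: (Rintegral_finite_support (s := s)) => // x /=; rewrite in_itv/= => xab xs.
have [s' hs'] := hs _ xs.
rewrite (@line_integral_dpart _ (ey2 R) (fun y => (x, y)) s')//.
- by rewrite per// subrr.
- by move=> h y; congr pair; rewrite /=; [rewrite [h *: 0]mulr0 add0r|rewrite [h *: 1]mulr1].
- by move=> y; exact: (cvg_pair (cvg_cst x) (@cvg_id _ (nbhs y))).
- by move=> y yab; rewrite /square/= xab.
- by move=> y ys k hk; apply/interior_swap; exact: hs'.
- by apply: bmeas_section2 bd _ => //=; rewrite in_itv.
Qed.

End gauss.

(** * Stability of graph viscosity *)

(** Cauchy-Schwarz for [r j / sqrt (d j)], without dividing by [d j], which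
    may vanish. *)
Lemma sqr_sum_le (R : realFieldType) (J : Type) (s : seq J) (r d e : J -> R) :
  (forall j, [/\ 0 <= d j, 0 <= e j & r j ^+ 2 <= 4 * (d j * e j)]) ->
  (\sum_(j <- s) r j) ^+ 2 <= 4 * ((\sum_(j <- s) d j) * (\sum_(j <- s) e j)).
Proof.
move=> h; suff [] : [/\ 0 <= \sum_(j <- s) d j, 0 <= \sum_(j <- s) e j &
    (\sum_(j <- s) r j) ^+ 2 <= 4 * ((\sum_(j <- s) d j) * (\sum_(j <- s) e j))] by [].
elim: s => [|j s [D0 E0 IH]]; first by rewrite !big_nil; split; lra.
rewrite !big_cons; have [d0 e0 hr] := h j.
set D := \sum_(j <- s) d j in D0 IH *; set E := \sum_(j <- s) e j in E0 IH *.
set S := \sum_(j <- s) r j in IH *.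
split; try exact: addr_ge0.
have hX : 0 <= D * e j + d j * E by rewrite addr_ge0// mulr_ge0.
have : `|r j * S| <= 2 * (D * e j + d j * E).
  rewrite -(@ler_pXn2r _ 2)// ?nnegrE ?mulr_ge0//.
  rewrite -normrX ger0_norm ?sqr_ge0// exprMn.
  have h2 : r j ^+ 2 * S ^+ 2 <= (4 * (d j * e j)) * (4 * (D * E)).
    by apply: ler_pM => //; exact: sqr_ge0.
  apply: le_trans h2 _.
  by have := sqr_ge0 (D * e j - d j * E); lra.
by rewrite ler_norml => /andP[_ h3]; lra.
Qed.

Section graph_viscosity.
Context (R : realFieldType) (I : nat).
Variables (m U W : 'I_I -> R) (cx cy d : 'I_I -> 'I_I -> R).
Variables (Fx Fy Px Py : 'I_I -> R) (tau : R).
Let D i j := U j - U i.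
Let G i j k := Fx k * cx i j + Fy k * cy i j.
Let P i j k := Px k * cx i j + Py k * cy i j.
Let E i j := D i j * G i j j - (P i j j - P i j i) - d i j * D i j ^+ 2 / 2.
Let r i j := d i j * D i j - (G i j j - G i j i).

(** With [q = U F - P] the entropy flux of [u^2 / 2], the identity
    [U i * r = E + d (U j^2 - U i^2) / 2 - (q_j - q_i)] holds for each pair up
    to the contraction of [q] with [c i j]; summed over all pairs, the viscous
    and the flux terms cancel. There remain [2 E] from this identity and at
    most [- E] from the square of the increment, and [E <= 0]. *)
Lemma graph_viscosity_stable :
  (forall i, 0 < m i) -> 0 < tau ->
  (forall i j, 0 <= d i j) -> (forall i j, d i j = d j i) ->
  (forall i, \sum_j cx i j = 0) -> (forall i, \sum_j cy i j = 0) ->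
  (forall j, \sum_i cx i j = 0) -> (forall j, \sum_i cy i j = 0) ->
  (forall i j, E i j <= 0 /\ r i j ^+ 2 <= - (4 * d i j * E i j)) ->
  (forall i, tau * (4 * \sum_j d i j) <= m i) ->
  (forall i, m i * ((W i - U i) / tau) +
     \sum_j (G i j j - d i j * (U j - U i)) = 0) ->
  \sum_i W i ^+ 2 * m i <= \sum_i U i ^+ 2 * m i.
Proof.
move=> m0 tau0 d0 ds rowx rowy colx coly dis cfl step.
have rowG i k : \sum_j G i j k = 0.
  by rewrite big_split/= -!mulr_sumr rowx rowy !mulr0 addr0.
have S i : m i * (W i - U i) = tau * \sum_j r i j.
  have rE : \sum_j (G i j j - d i j * (U j - U i)) = - \sum_j r i j.
    transitivity (\sum_j (G i j j - d i j * (U j - U i)) - \sum_j G i j i).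
      by rewrite rowG subr0.
    rewrite -sumrB -sumrN.
    by apply: eq_bigr => j _; rewrite /r /D; ring.
  have := step i; rewrite rE mulrA => /eqP; rewrite subr_eq0 => /eqP <-.
  by field; lra.
(* The bound on tau turns the square of the increment into [- E]. *)
have loc i : W i ^+ 2 * m i - U i ^+ 2 * m i <=
    tau * \sum_j (2 * U i * r i j - E i j).
  have hC : (\sum_j r i j) ^+ 2 <= 4 * ((\sum_j d i j) * (\sum_j - E i j)).
    apply: sqr_sum_le => j; have [h1 h2] := dis i j.
    by rewrite d0 oppr_ge0 h1; split => //; lra.
  have E0 : 0 <= \sum_j - E i j.
    by apply: sumr_ge0 => j _; rewrite oppr_ge0; have [] := dis i j.
  rewrite big_split/= -mulr_sumr; set s := \sum_j r i j in hC S *.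
  have := S i; rewrite -/s => Si.
  have h1 : (m i * (W i - U i)) ^+ 2 <= m i * (tau * \sum_j - E i j).
    rewrite Si exprMn; apply: (@le_trans _ _ (tau * ((tau * (4 * \sum_j d i j)) * (\sum_j - E i j)))).
      by rewrite expr2 -!mulrA ler_pM2l// ler_pM2l// mulrA -mulrA; lra.
    by rewrite [leRHS]mulrCA ler_pM2l// ler_wpM2r.
  have h2 : m i * (W i - U i) ^+ 2 <= tau * \sum_j - E i j.
    by rewrite -(ler_pM2l (m0 i)); apply: le_trans h1; lra.
  have h3 : U i * (m i * (W i - U i)) = U i * (tau * s) by rewrite Si.
  by move: h2 h3; lra.
have key : \sum_i \sum_j (2 * U i * r i j - E i j) <= 0.
  have eqn i j : 2 * U i * r i j - E i j = E i j + (d i j * U j ^+ 2 - d i j * U i ^+ 2)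
      - 2 * ((U j * G i j j - P i j j) - (U i * G i j i - P i j i)).
    by rewrite /E /r /D; field.
  under eq_bigr do under eq_bigr do rewrite eqn.
  have sE : \sum_i \sum_j E i j <= 0.
    by apply: sumr_le0 => i _; apply: sumr_le0 => j _; have [] := dis i j.
  have sd : \sum_i \sum_j (d i j * U j ^+ 2 - d i j * U i ^+ 2) = 0.
    under eq_bigr do rewrite sumrB; rewrite sumrB exchange_big/=.
    by under eq_bigr do under eq_bigr do rewrite ds; rewrite subrr.
  have sj : \sum_i \sum_j (U j * G i j j - P i j j) = 0.
    rewrite exchange_big/= big1// => j _.
    rewrite (eq_bigr (fun i => (U j * Fx j - Px j) * cx i j + (U j * Fy j - Py j) * cy i j)).
      by rewrite big_split/= -!mulr_sumr colx coly !mulr0 addr0.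
    by move=> i _; rewrite /G /P; ring.
  have si : \sum_i \sum_j (U i * G i j i - P i j i) = 0.
    rewrite big1// => i _.
    rewrite (eq_bigr (fun j => (U i * Fx i - Px i) * cx i j + (U i * Fy i - Py i) * cy i j)).
      by rewrite big_split/= -!mulr_sumr rowx rowy !mulr0 addr0.
    by move=> j _; rewrite /G /P; ring.
  rewrite (eq_bigr (fun i => \sum_j E i j +
     \sum_j (d i j * U j ^+ 2 - d i j * U i ^+ 2) -
     2 * (\sum_j (U j * G i j j - P i j j) - \sum_j (U i * G i j i - P i j i)))).
    by rewrite big_split/= big_split/= sd addr0 sumrN -mulr_sumr sumrB sj si; lra.
  by move=> i _; rewrite -sumrB mulr_sumr -big_split/= -sumrB.
rewrite -subr_le0 -sumrB; apply: le_trans (ler_sum _ (fun i _ => loc i)) _.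
by rewrite -mulr_sumr pmulr_rle0.
Qed.

End graph_viscosity.

(** * Galerkin matrices *)

Section galerkin.
Context (R : realType) (a b sigma : R) (Th : fe_mesh R).
Context (I : nat) (phi : 'I_I -> R * R -> R).
Implicit Types (p q e : R * R) (u v w : R * R -> R) (V : 'I_I -> R).
Notation mu := (@lebesgue_measure R).
Notation R2 := (measurableTypeR R * measurableTypeR R)%type.
Notation bsq := (bmeas (square a b : set R2)).
Hypothesis hab : a < b.
Hypothesis hTh : is_mesh a b sigma Th.
Hypothesis hphi : is_basis a b Th phi.
Hypothesis hunity : forall p, square a b p -> \sum_i phi i p = 1.

Let inner_int v w : inner a b v w = (\int[(mu \x mu)%E]_(p in square a b) (v p * w p))%R.
Proof. by []. Qed.

Let msq := @measurable_square R a b.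
Let fsq := @square_lty R a b.

Let bsq_integrable v : bsq v -> (mu \x mu)%E.-integrable (square a b) (EFin \o v).
Proof. by move=> bv; apply: bmeas_integrable. Qed.

Lemma innerC v w : inner a b v w = inner a b w v.
Proof. by apply: eq_Rintegral => p _; rewrite mulrC. Qed.

Lemma inner_sumr V (w : 'I_I -> R * R -> R) v u : bsq v -> (forall i, bsq (w i)) ->
  (forall p, square a b p -> u p = \sum_i V i * w i p) ->
  inner a b v u = \sum_i V i * inner a b v (w i).
Proof.
move=> bv bw uE; transitivity
    (\int[(mu \x mu)%E]_(p in square a b) \sum_i V i * (v p * w i p))%R.
  apply: eq_Rintegral => p /set_mem sp; rewrite uE// mulr_sumr.
  by apply: eq_bigr => i _; rewrite mulrCA.
rewrite Rintegral_sum//; last first.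
  by move=> i _; apply: bmeasZ; exact: bmeasM.
apply: eq_bigr => i _; rewrite RintegralZl//.
by apply: bsq_integrable; exact: bmeasM.
Qed.

Lemma innerBr v w w' u : bsq v -> bsq w -> bsq w' ->
  (forall p, square a b p -> u p = w p - w' p) ->
  inner a b v u = inner a b v w - inner a b v w'.
Proof.
move=> bv bw bw' uE; rewrite !inner_int -RintegralB//; try (apply: bsq_integrable; exact: bmeasM).
by apply: eq_Rintegral => p /set_mem sp; rewrite uE// mulrBr.
Qed.

Lemma innerZr v w (x : R) : bsq v -> bsq w ->
  inner a b v (fun p => x * w p) = x * inner a b v w.
Proof.
move=> bv bw; rewrite !inner_int -RintegralZl//; last by apply: bsq_integrable; exact: bmeasM.
by apply: eq_Rintegral => p _; rewrite mulrCA.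
Qed.

Lemma inner_ge0 v : 0 <= inner a b v v.
Proof. by rewrite inner_int Rintegral_ge0// => p _; rewrite -expr2 sqr_ge0. Qed.

Lemma Vh_pw v : Vh a b Th v -> pwC1 a b Th v.
Proof. by apply: Vh_pwC1 => k; exact: mesh_aff hTh k. Qed.

Lemma phi_pw i : pwC1 a b Th (phi i).
Proof. by have [h _ _] := hphi; exact: Vh_pw. Qed.

Lemma bsq_dpart v e : pwC1 a b Th v -> bsq (dpart Th e v).
Proof. by move=> hv; apply: dpart_bmeas hv; exact: mesh_sub hTh. Qed.

Lemma cell_near_square p : cells_int Th p -> \forall p' \near p, square a b p'.
Proof.
move=> [k _ kp]; apply: filterS kp => p' kp'; exact: mesh_sub hTh k _ kp'.
Qed.

Lemma inner_dpart_sum v e V : bsq v ->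
  inner a b v (dpart Th e (fe_fun phi V)) =
  \sum_i V i * inner a b v (dpart Th e (phi i)).
Proof.
move=> bv; apply: inner_sumr => // [i|p _]; first exact: bsq_dpart (phi_pw i).
by apply: dpart_sum; exact: phi_pw.
Qed.

(** The sum of the shape functions is constant. *)
Lemma dpart_unity e p : dpart Th e (fe_fun phi (fun=> 1)) p = 0.
Proof.
have [Op|np] := pselect (cells_int Th p); last by rewrite dpart_out.
rewrite /dpart mem_set//.
have h : is_derive p e (fe_fun phi (fun=> 1)) 0.
  apply: (near_eq_is_derive (f := cst 1 : R * R -> R)).
  apply: filterS (cell_near_square Op) => p' sp'.
  by rewrite /fe_fun/= -[LHS](hunity sp'); apply: eq_bigr => i _; rewrite mul1r.
by have [_ ->] := h.
Qed.

Lemma stencil_sym i j : stencil a b phi i j = stencil a b phi j i.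
Proof.
by rewrite /stencil; apply/idP/idP => /asboolP[p sp h]; apply/asboolP;
  exists p => //; rewrite mulrC.
Qed.

(** Where [phi i] does not vanish it does not vanish nearby, so [phi j] is
    zero nearby, and so is its derivative. *)
Lemma inner_off_stencil e i j : ~~ stencil a b phi i j ->
  inner a b (phi i) (dpart Th e (phi j)) = 0.
Proof.
move=> /asboolP nst.
have h0 p : square a b p -> phi i p != 0 -> phi j p = 0.
  move=> sp hi; apply/eqP; apply: contra_notT nst => hj.
  by exists p => //; rewrite mulf_neq0.
transitivity (\int[(mu \x mu)%E]_(p in square a b) (0 : R))%R; last first.
  by rewrite Rintegral_cst// mul0r.
apply: eq_Rintegral => p /set_mem sp.
have [Op|np] := pselect (cells_int Th p); last by rewrite dpart_out ?mulr0.
have [->|hi] := eqVneq (phi i p) 0; first by rewrite mul0r.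
suff -> : dpart Th e (phi j) p = 0 by rewrite mulr0.
have ci : {for p, continuous (phi i)}.
  exact: continuous_pwC1 (phi_pw i) Op.
rewrite /dpart mem_set//.
have h : is_derive p e (phi j) 0.
  apply: (near_eq_is_derive (f := cst 0 : R * R -> R)).
  have nz : \forall p' \near p, phi i p' != 0 by exact: cvgr_neq0 ci _.
  near=> p'; rewrite /= h0//; near: p'; [exact: cell_near_square|exact: nz].
by have [_ ->] := h.
Unshelve. all: by end_near. Qed.

Lemma inner_row_sum e i : \sum_j inner a b (phi i) (dpart Th e (phi j)) = 0.
Proof.
have bi := pwC1_bmeas (phi_pw i).
have := inner_dpart_sum e (fun=> 1) bi.
under eq_bigr do rewrite mul1r.
move=> <-; rewrite inner_int.
under eq_Rintegral do rewrite dpart_unity mulr0.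
by rewrite Rintegral_cst// mul0r.
Qed.

Lemma inner_col_sum e j : \sum_i inner a b (phi i) (dpart Th e (phi j)) =
  (\int[(mu \x mu)%E]_(p in square a b) dpart Th e (phi j) p)%R.
Proof.
have bj := bsq_dpart e (phi_pw j).
have one p : square a b p -> 1 = \sum_i 1 * phi i p.
  by move=> sp; rewrite -[LHS](hunity sp); apply: eq_bigr => i _; rewrite mul1r.
transitivity (\sum_i 1 * inner a b (dpart Th e (phi j)) (phi i)).
  by apply: eq_bigr => i _; rewrite mul1r innerC.
rewrite -(inner_sumr (u := fun=> 1) bj (fun i => pwC1_bmeas (phi_pw i)))//.
by apply: eq_Rintegral => p _; rewrite mulr1.
Qed.

Lemma cvec_row1 i : \sum_j (cvec a b Th phi i j).1 = 0.
Proof. exact: inner_row_sum. Qed.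

Lemma cvec_row2 i : \sum_j (cvec a b Th phi i j).2 = 0.
Proof. exact: inner_row_sum. Qed.

Lemma cvec_col1 j : \sum_i (cvec a b Th phi i j).1 = 0.
Proof.
rewrite inner_col_sum; apply: (gauss_x hab hTh (phi_pw j)).
by move=> y yab; have [/(_ j)[_ /(_ _ yab)[]]] := hphi.
Qed.

Lemma cvec_col2 j : \sum_i (cvec a b Th phi i j).2 = 0.
Proof.
rewrite inner_col_sum; apply: (gauss_y hab hTh (phi_pw j)).
by move=> x xab; have [/(_ j)[_ /(_ _ xab)[]]] := hphi.
Qed.

Lemma cvec_off_stencil i j : ~~ stencil a b phi i j -> cvec a b Th phi i j = 0.
Proof. by move=> h; rewrite /cvec !inner_off_stencil. Qed.

(** Half the integral of the derivative of [v^2]. *)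
Lemma inner_dx_self v : Vh a b Th v -> inner a b (dx Th v) v = 0.
Proof.
move=> hv; have pv := Vh_pw hv; have bv := pwC1_bmeas pv.
have : (\int[(mu \x mu)%E]_(p in square a b) dx Th (fun p => v p * v p) p)%R = 0.
  apply: (gauss_x hab hTh (pwC1M pv pv)) => y yab.
  by have [_ /(_ _ yab)[-> _] _] := hv.
under eq_Rintegral do rewrite /dx (dpart_sqr _ _ pv).
rewrite RintegralZl//; last by apply: bsq_integrable; apply: bmeasM => //; exact: bsq_dpart.
by rewrite -inner_int => /eqP; rewrite mulf_eq0 pnatr_eq0/= => /eqP.
Qed.

End galerkin.

(** * The two steps of the scheme *)

Lemma lipschitz_continuous (R : realType) (V W : normedModType R) (f : V -> W) :
  lipschitz f -> continuous f.
Proof.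
move=> [M [_ hM]] x; pose K := `|M| + 1.
have K0 : 0 < K by rewrite ltr_wpDl.
have hK : forall y, `|f x - f y| <= K * `|x - y|.
  have MK : M < K by rewrite /K (le_lt_trans (ler_norm M))// ltrDl.
  by move=> y; exact: (hM K MK (x, y)).
apply/cvgrPdist_le => e e0; near=> y.
rewrite (le_trans (hK y))// mulrC -ler_pdivlMr//.
by near: y; apply: cvgr_dist_le; [exact: cvg_id|rewrite divr_gt0].
Unshelve. all: by end_near. Qed.

(** Pure algebra of the test with [u]: [M] collects the mass terms and
    [A, B, C, D] the four inner products with the derivatives of a shape
    function. *)
Lemma weighted_sum_eq (R : realFieldType) (I : nat) (eps c : R)
    (U M A B C D : 'I_I -> R) (sA sB sC sD : R) :
  sA = \sum_i U i * A i -> sB = \sum_i U i * B i ->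
  sC = \sum_i U i * C i -> sD = \sum_i U i * D i ->
  (forall i, M i - eps * A i - eps * B i - eps * c * C i - eps * c * D i = 0) ->
  \sum_i U i * M i = eps * sA + eps * sB + eps * c * sC + eps * c * sD.
Proof.
move=> -> -> -> -> h; rewrite !mulr_sumr -!big_split/=; apply: eq_bigr => i _.
transitivity (U i * (eps * A i + eps * B i + eps * c * C i + eps * c * D i)).
  by congr (_ * _); have := h i; lra.
by ring.
Qed.

(** [xx] and [yy] stand for [|p|^2] and [|q|^2], the equations for [s1] to
    [s4] come from [u_x = z - p] and [u_y = g - q], and the two last equations
    are the constraints tested with [z] and [g]. *)
Lemma energy_balance_le0 (R : realFieldType)
    (eps c s1 s2 s3 s4 xz xdz yg ydg xx yy X : R) :
  0 < eps -> 0 < c ->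
  X = eps * s1 + eps * s2 + eps * c * s3 + eps * c * s4 ->
  s1 = - xdz -> s2 = - ydg -> s3 = xz - xx -> s4 = yg - yy ->
  c * xz - xdz = 0 -> c * yg - ydg = 0 -> 0 <= xx -> 0 <= yy -> X <= 0.
Proof.
move=> eps0 c0 -> -> -> -> -> h1 h2 x0 y0.
rewrite (_ : _ + _ = - (eps * c * (xx + yy)) +
    eps * ((c * xz - xdz) + (c * yg - ydg))); last by ring.
rewrite h1 h2 !addr0 mulr0 addr0 oppr_le0 mulr_ge0 ?addr_ge0//.
by rewrite mulr_ge0// ltW.
Qed.

Lemma sqr_diff_le (R : realFieldType) (m x y : R) : 0 <= m ->
  x ^+ 2 * m - y ^+ 2 * m <= 2 * (x * (m * (x - y))).
Proof. by move=> m0; have := mulr_ge0 m0 (sqr_ge0 (x - y)); lra. Qed.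

Section steps.
Context (R : realType) (a b sigma : R) (Th : fe_mesh R).
Context (I : nat) (phi : 'I_I -> R * R -> R).
Hypothesis hab : a < b.
Hypothesis hTh : is_mesh a b sigma Th.
Hypothesis hphi : is_basis a b Th phi.
Hypothesis hunity : forall p, square a b p -> \sum_i phi i p = 1.
Hypothesis hmass : forall i, 0 < mass a b phi i.

(** The test functions are [u], [z] and [g]; after substitution only minus the
    squares of the residuals [p] and [q] remain. *)
Lemma dispersive_energy (eps c tau : R) (W U : 'I_I -> R) (z g p q : R * R -> R) :
  0 < eps -> 0 < c -> 0 < tau -> Vh a b Th z -> Vh a b Th g ->
  (forall x, p x = z x - dx Th (fe_fun phi U) x) ->
  (forall x, q x = g x - dy Th (fe_fun phi U) x) ->
  (forall i, mass a b phi i * ((U i - W i) / tau)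
        - eps * inner a b (dx Th z) (dx Th (phi i))
        - eps * inner a b (dx Th g) (dy Th (phi i))
        - eps * c * inner a b p (dx Th (phi i))
        - eps * c * inner a b q (dy Th (phi i)) = 0) ->
  inner a b p (fun x => c * z x - dx Th z x) = 0 ->
  inner a b q (fun x => c * g x - dx Th g x) = 0 ->
  \sum_i U i ^+ 2 * mass a b phi i <= \sum_i W i ^+ 2 * mass a b phi i.
Proof.
move=> eps0 c0 tau0 hz hg hp hq eqU eqp eqq.
pose u := fe_fun phi U.
have pz := Vh_pw hTh hz; have pg := Vh_pw hTh hg.
have bz := pwC1_bmeas pz; have bg := pwC1_bmeas pg.
have bdz := bsq_dpart hTh (ex2 R) pz; have bdg := bsq_dpart hTh (ex2 R) pg.
have bdu e : bmeas (square a b : set (measurableTypeR R * measurableTypeR R)%type)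
    (dpart Th e u).
  apply: (bmeas_eq (f := fun p : R * R => \sum_i U i * dpart Th e (phi i) p)).
    by move=> x _; rewrite (@dpart_sum _ a b)// => i; exact: phi_pw hTh hphi i.
  by apply: bmeas_sum => i _; apply: bmeasZ; exact: (bsq_dpart hTh e (phi_pw hTh hphi i)).
have bp := bmeas_eq (fun x _ => esym (hp x)) (bmeasB bz (bdu (ex2 R))).
have bq := bmeas_eq (fun x _ => esym (hq x)) (bmeasB bg (bdu (ey2 R))).
have Sum v e := @inner_dpart_sum R a b sigma Th I phi hTh hphi v e U.
have S1 : inner a b (dx Th z) (dx Th u) = \sum_i U i * inner a b (dx Th z) (dx Th (phi i)).
  exact: Sum.
have S2 : inner a b (dx Th g) (dy Th u) = \sum_i U i * inner a b (dx Th g) (dy Th (phi i)).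
  exact: Sum.
have S3 : inner a b p (dx Th u) = \sum_i U i * inner a b p (dx Th (phi i)).
  exact: Sum.
have S4 : inner a b q (dy Th u) = \sum_i U i * inner a b q (dy Th (phi i)).
  exact: Sum.
have T := weighted_sum_eq S1 S2 S3 S4 eqU.
have ux x : dx Th u x = z x - p x by rewrite hp opprB addrC subrK.
have uy x : dy Th u x = g x - q x by rewrite hq opprB addrC subrK.
have e1 : inner a b (dx Th z) (dx Th u) = - inner a b p (dx Th z).
  have := innerBr bdz bz bp (fun x _ => ux x).
  by rewrite (inner_dx_self hab hTh hz) sub0r (innerC _ _ (dx Th z) p).
have e2 : inner a b (dx Th g) (dy Th u) = - inner a b q (dx Th g).
  have := innerBr bdg bg bq (fun x _ => uy x).
  by rewrite (inner_dx_self hab hTh hg) sub0r (innerC _ _ (dx Th g) q).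
have e3 : inner a b p (dx Th u) = inner a b p z - inner a b p p :=
  innerBr bp bz bp (fun x _ => ux x).
have e4 : inner a b q (dy Th u) = inner a b q g - inner a b q q :=
  innerBr bq bg bq (fun x _ => uy x).
have e5 : c * inner a b p z - inner a b p (dx Th z) = 0.
  have := innerBr bp (bmeasZ c bz) bdz (fun x _ => erefl).
  by rewrite (innerZr c bp bz) eqp => /esym.
have e6 : c * inner a b q g - inner a b q (dx Th g) = 0.
  have := innerBr bq (bmeasZ c bg) bdg (fun x _ => erefl).
  by rewrite (innerZr c bq bg) eqq => /esym.
have T0 : \sum_i U i * (mass a b phi i * ((U i - W i) / tau)) <= 0.
  exact: (energy_balance_le0 eps0 c0) T e1 e2 e3 e4 e5 e6 (inner_ge0 _ _ _) (inner_ge0 _ _ _).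
have T1 : \sum_i U i * (mass a b phi i * (U i - W i)) <= 0.
  rewrite -(pmulr_lle0 _ (_ : 0 < tau^-1)) ?invr_gt0// mulr_suml.
  by apply: le_trans T0; rewrite le_eqVlt; apply/orP; left; apply/eqP;
    apply: eq_bigr => i _; ring.
rewrite -subr_le0 -sumrB; apply: (@le_trans _ _ (2 * \sum_i U i * (mass a b phi i * (U i - W i)))).
  rewrite mulr_sumr; apply: ler_sum => i _.
  exact: sqr_diff_le (ltW (hmass i)).
by rewrite pmulr_rle0.
Qed.

Lemma dispersive_step_stable (eps c tau : R) (W U : 'I_I -> R) (z g : R * R -> R) :
  0 < eps -> 0 < c -> 0 < tau -> Vh a b Th z -> Vh a b Th g ->
  dispersive_step a b Th phi eps c tau W U z g ->
  \sum_i U i ^+ 2 * mass a b phi i <= \sum_i W i ^+ 2 * mass a b phi i.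
Proof.
move=> eps0 c0 tau0 hz hg [eqU eqp eqq].
exact: (dispersive_energy eps0 c0 tau0 hz hg (fun=> erefl) (fun=> erefl) eqU (eqp z hz) (eqq g hg)).
Qed.

Lemma dvisc_ge (lam : R * R -> R -> R -> R) (U : 'I_I -> R) i j :
  lam (nvec a b Th phi i j) (U i) (U j) * enorm2 (cvec a b Th phi i j) <=
  dvisc a b Th phi lam U i j.
Proof. by rewrite /dvisc le_max; apply/orP; left; exact: lexx. Qed.

Lemma dviscC (lam : R * R -> R -> R -> R) (U : 'I_I -> R) i j :
  dvisc a b Th phi lam U i j = dvisc a b Th phi lam U j i.
Proof. exact: maxC. Qed.

Lemma enorm2_0 (p : R * R) : (enorm2 p == 0) = (p == 0).
Proof.
apply/eqP/eqP => [|->]; last by rewrite /enorm2 /dot2/= !mul0r addr0 sqrtr0.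
move/eqP; rewrite sqrtr_eq0 /dot2 => h; rewrite [p]surjective_pairing.
have h1 := sqr_ge0 p.1; have h2 := sqr_ge0 p.2.
by congr pair; apply/eqP; rewrite -sqrf_eq0; apply/eqP; lra.
Qed.

Lemma enorm2Z (x : R) (p : R * R) : enorm2 (x *: p) = `|x| * enorm2 p.
Proof.
rewrite /enorm2 (_ : dot2 _ _ = x ^+ 2 * dot2 p p); last first.
  by rewrite /dot2/= /GRing.scale/=; ring.
by rewrite sqrtrM ?sqr_ge0// sqrtr_sqr.
Qed.

(** [riemann_dissipation] for the flux in the unit direction of [c], with
    viscosity [d / |c|], multiplied by [|c|^2]. *)
Lemma riemann_dissipation2 (f : R -> R * R) (Px Py : R -> R) (uL uR lam d : R)
    (c : R * R) (D := uR - uL) (n := enorm2 c)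
    (E := D * dot2 (f uR) c - (dot2 (Px uR, Py uR) c - dot2 (Px uL, Py uL) c)
       - d * D ^+ 2 / 2) :
  (c != 0 -> wave_speed_bound (fun s => dot2 (f s) (n^-1 *: c)) uL uR lam) ->
  0 <= d -> lam * n <= d ->
  (forall x : R, is_derive x 1 Px (f x).1) ->
  (forall x : R, is_derive x 1 Py (f x).2) ->
  E <= 0 /\ (d * D - (dot2 (f uR) c - dot2 (f uL) c)) ^+ 2 <= - (4 * d * E).
Proof.
move=> hw d0 lamd dPx dPy.
have [c0|c0] := eqVneq c 0.
  rewrite /E c0 /dot2/= !mulr0 !addr0 !subr0 mulr0 !sub0r.
  have h : 0 <= d * D ^+ 2 by rewrite mulr_ge0// sqr_ge0.
  by have := sqr_ge0 (d * D); split; lra.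
have n0 : 0 < n by rewrite lt_neqAle eq_sym enorm2_0 c0 sqrtr_ge0.
have nE x : dot2 x (n^-1 *: c) = n^-1 * dot2 x c.
  by rewrite /dot2 !mulrDr [in LHS]mulrCA [X in _ + X = _]mulrCA.
have dP (x : R) : is_derive x 1 (fun s => n^-1 * (c.1 * Px s + c.2 * Py s))
    (dot2 (f x) (n^-1 *: c)).
  have -> : dot2 (f x) (n^-1 *: c) = n^-1 * (c.1 * (f x).1 + c.2 * (f x).2).
    by rewrite nE /dot2; ring.
  by apply: is_deriveZ; apply: is_deriveD; exact: is_deriveZ.
have ld : lam <= d / n by rewrite ler_pdivlMr.
have [h1 h2] := riemann_dissipation (hw c0) ld dP.
rewrite !nE in h1 h2.
set E' := _ - _ - _ in h1 h2.
have EE' : E = n * E' by rewrite /E /E' /D /dot2/=; field; rewrite gt_eqF.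
split; first by rewrite EE' pmulr_rle0.
have := ler_wpM2l (sqr_ge0 n) h2; rewrite -exprMn EE'.
congr (_ <= _); first by congr (_ ^+ 2); rewrite /D; field; rewrite gt_eqF.
by field; rewrite gt_eqF.
Qed.

(** Off the stencil both [c_ij] and [d_ij] vanish, so every sum over the
    stencil is a full sum. *)
Lemma hyperbolic_step_stable (f : R -> R * R) (lam : R * R -> R -> R -> R)
    (tau : R) (U W : 'I_I -> R) :
  lipschitz f -> 0 < tau ->
  (forall (nu : R * R) (uL uR : R), enorm2 nu = 1 ->
     wave_speed_bound (fun s => dot2 (f s) nu) uL uR (lam nu uL uR)) ->
  hyperbolic_step a b Th phi f lam tau U W ->
  (tau%:E <= tau_star a b Th phi lam U)%E ->
  \sum_i W i ^+ 2 * mass a b phi i <= \sum_i U i ^+ 2 * mass a b phi i.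
Proof.
move=> hf tau0 hlam step cfl.
have cf := lipschitz_continuous hf.
have [Px dPx] : exists F : R -> R, forall x : R, is_derive x 1 F (f x).1.
  apply: continuous_primitive => x.
  exact: (cvg_comp _ _ (cf x) ((C1_fst R).1 (f x))).
have [Py dPy] : exists F : R -> R, forall x : R, is_derive x 1 F (f x).2.
  apply: continuous_primitive => x.
  exact: (cvg_comp _ _ (cf x) ((C1_snd R).1 (f x))).
pose C i j := cvec a b Th phi i j; pose d i j := dvisc a b Th phi lam U i j.
have nn0 i j : C i j != 0 -> enorm2 (nvec a b Th phi i j) = 1.
  move=> c0; have n0 : 0 < enorm2 (C i j).
    by rewrite lt_neqAle eq_sym enorm2_0 c0 sqrtr_ge0.
  rewrite /nvec -/(C i j) [LHS]enorm2Z ger0_norm ?invr_ge0 ?ltW// mulVf//.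
  by rewrite gt_eqF.
have d0 i j : 0 <= d i j.
  apply: le_trans (dvisc_ge lam U i j); rewrite -/(C i j).
  have [->|c0] := eqVneq (C i j) 0.
    by rewrite (eqP (_ : enorm2 0 == 0)) ?mulr0// enorm2_0.
  have [l0 _] := hlam _ (U i) (U j) (nn0 i j c0).
  by rewrite mulr_ge0// sqrtr_ge0.
have off i j : ~~ stencil a b phi i j -> d i j = 0.
  move=> h; rewrite /d /dvisc (cvec_off_stencil hTh hphi h).
  rewrite stencil_sym in h; rewrite (cvec_off_stencil hTh hphi h).
  by rewrite (eqP (_ : enorm2 0 == 0)) ?mulr0 ?maxxx// enorm2_0.
have ds i j : d i j = d j i := dviscC lam U i j.
refine (@graph_viscosity_stable _ _ _ _ _ (fun i j => (C i j).1) (fun i j => (C i j).2)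
  d (fun i => (f (U i)).1) (fun i => (f (U i)).2) (fun i => Px (U i)) (fun i => Py (U i)) tau
  hmass tau0 d0 ds (cvec_row1 hTh hphi hunity) (cvec_row2 hTh hphi hunity)
  (cvec_col1 hab hTh hphi hunity) (cvec_col2 hab hTh hphi hunity) _ _ _).
- move=> i j; have := @riemann_dissipation2 f Px Py (U i) (U j)
    (lam (nvec a b Th phi i j) (U i) (U j)) (d i j) (C i j)
    (fun c0 => hlam _ (U i) (U j) (nn0 i j c0)) (d0 i j) (dvisc_ge lam U i j) dPx dPy.
  exact.
- move=> i; set S := \sum_j d i j.
  have -> : S = \sum_(j | stencil a b phi i j) d i j.
    rewrite [RHS]big_mkcond/=; apply: eq_bigr => j _.
    by case: ifPn => // h; rewrite off.
  have S0 : 0 <= \sum_(j | stencil a b phi i j) d i j by rewrite sumr_ge0.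
  have := le_trans cfl (bigmin_le _ i _); rewrite -/(d i) /=.
  case: eqP => [E _|/eqP Sn0 h]; first by rewrite /d E !mulr0 ltW.
  have Sp : 0 < 4 * \sum_(j | stencil a b phi i j) d i j.
    by rewrite mulr_gt0// lt0r; apply/andP.
  by rewrite -ler_pdivlMr// -lee_fin.
- move=> i; rewrite -[RHS](step i); congr (_ + _); rewrite [RHS]big_mkcond/=.
  apply: eq_bigr => j _; case: ifPn => // h; rewrite off// /C.
  by rewrite /dx /dy !(inner_off_stencil hTh hphi _ h) !mulr0 mul0r addr0 subr0.
Qed.
End steps.

Theorem theorem3p9 (R : realType) (a b : R) (hab : a < b)
  (f : R -> R * R) (hf : lipschitz f)
  (eps c tau : R) (heps : 0 < eps) (hc : 0 < c) (htau : 0 < tau)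
  (Th : fe_mesh R) (sigma : R) (hTh : is_mesh a b sigma Th)
  (I : nat) (phi : 'I_I -> R * R -> R) (hphi : is_basis a b Th phi)
  (hunity : forall p, square a b p -> \sum_i phi i p = 1)
  (hmass : forall i, 0 < mass a b phi i)
  (lam : R * R -> R -> R -> R)
  (hlam : forall (nu : R * R) (uL uR : R), enorm2 nu = 1 ->
     wave_speed_bound (fun s => dot2 (f s) nu) uL uR (lam nu uL uR))
  (n : nat) (U W : nat -> 'I_I -> R) (z g : nat -> R * R -> R)
  (hW : hyperbolic_step a b Th phi f lam tau (U n) (W n.+1))
  (hz : Vh a b Th (z n.+1)) (hg : Vh a b Th (g n.+1))
  (hU : dispersive_step a b Th phi eps c tau
          (W n.+1) (U n.+1) (z n.+1) (g n.+1))
  (htau_star : (tau%:E <= tau_star a b Th phi lam (U n))%E) :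
  lumped_norm a b phi (U n.+1) <= lumped_norm a b phi (U n).
Proof.
apply: ler_wsqrtr; apply: (@le_trans _ _ (\sum_i W n.+1 i ^+ 2 * mass a b phi i)).
  exact: (dispersive_step_stable hab hTh hphi hmass heps hc htau hz hg hU).
exact: (hyperbolic_step_stable hab hTh hphi hunity hmass hf htau hlam hW htau_star).
Qed.
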